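(* For a single-commodity network $G$ (a directed graph with designated source $s$ and destination $t$) with unknown demands and affine costs, full information revelation is always an optimal signaling scheme if and only if $G$ is series-parallel. Here ''always'' means: for all affine edge costs $c_e(x)=a_ex+b_e$ (with $a_e>0$, $b_e\ge 0$), all finite state sets $\Theta$ with demands $(d_\theta)_{\theta\in\Theta}$, and all priors $\mu^*\in\Delta(\Theta)$, full information revelation minimizes $C(\varphi)$ over all signaling schemes $\varphi$.
   Context: Network congestion game with unknown demand (single commodity). $G=(V,E)$ is a directed graph (parallel edges allowed) with source $s\in V$ and destination $t\in V$. Every edge $e$ has an affine cost function $c_e(x)=a_e x+b_e$ with $a_e\in\mathbb{R}_{>0}$, $b_e\in\mathbb{R}_{\ge 0}$. $\Theta=\{\theta_1,\dots,\theta_l\}$ is a finite set of states of nature; state $\theta$ is associated with a demand $d_\theta$, where (without loss of generality, after normalization) $0<d_{\theta_1}<\dots<d_{\theta_l}=1$. $\Delta(\Theta)$ is the set of probability distributions on $\Theta$. $\mathcal{P}$ is the set of directed $s$-$t$-paths. A path flow is a vector $x=(x_P)_{P\in\mathcal{P}}$ with $x_P\ge 0$ and $\sum_{P}x_P=1$. The load of $x$ on $e$ is $x_e=\sum_{P\in\mathcal{P}:e\in P}x_P$. For $\mu\in\Delta(\Theta)$ the expected cost of $e$ is $c_e(x_e\mid\mu)=\sum_{\theta\in\Theta}\mu_\theta d_\theta c_e(d_\theta x_e)$ and that of a path is $c_P(x\mid\mu)=\sum_{e\in P}c_e(x_e\mid\mu)$. A path flow $x$ is a Wardrop equilibrium for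 $\mu$ if $c_P(x\mid\mu)\le c_Q(x\mid\mu)$ for all $P,Q\in\mathcal{P}$ with $x_P>0$. The Wardrop equilibrium $x^*(\mu)$ is unique (in terms of edge loads), and $C(\mu)=\sum_{e\in E}x^*_e(\mu)\,c_e(x^*_e(\mu)\mid\mu)$ is its total cost. Signaling. $\mu^*\in\Delta(\Theta)$ is a prior and $\Sigma$ a sufficiently large finite set of public signals. A signaling scheme is a matrix $\varphi=(\varphi_{\theta,\sigma})_{\theta\in\Theta,\sigma\in\Sigma}$ with $\varphi_{\theta,\sigma}\ge 0$ and $\sum_{\sigma}\varphi_{\theta,\sigma}=\mu^*_\theta$ for all $\theta$. Let $\varphi_\sigma=\sum_\theta\varphi_{\theta,\sigma}$; for $\varphi_\sigma>0$ the conditional distribution $\mu_\sigma\in\Delta(\Theta)$ is $\mu_{\theta,\sigma}=\varphi_{\theta,\sigma}/\varphi_\sigma$. The cost of the scheme is $C(\varphi)=\sum_{\sigma:\varphi_\sigma>0}\varphi_\sigma C(\mu_\sigma)$. A scheme is optimal if it minimizes $C(\varphi)$. Full information revelation is the scheme with one individual signal $\sigma_\theta$ for each state $\theta$ (pairwise distinct), which is sent deterministically in state $\theta$, i.e., $\varphi_{\theta,\sigma_\theta}=\mu^*_\theta$ and all other entries are $0$. Series-parallel graphs. A graph with two designated vertices $s,t$ is series-parallel if it consists only of a single edge between $s$ and $t$, or is obtained from two series-parallel graphs $G_1$ (with designated vertices $s_1,t_1$) and $G_2$ (with designated vertices $s_2,t_2$) by parallel composition (take the disjoint union, merge $s_1,s_2$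 into a new vertex $s$ and $t_1,t_2$ into a new vertex $t$) or by serial composition (take the disjoint union, merge $t_1$ and $s_2$, rename $s_1$ to $s$ and $t_2$ to $t$). Series-parallel graphs are treated as directed graphs by directing every edge in the orientation in which it appears in any path from $s$ to $t$.
   Formalization: The network is assumed to have distinct source and destination, with every vertex and every edge on some simple directed s-t-path; without this the equivalence fails, e.g. for a single s-t edge plus an isolated vertex. *)

(* Defs.v *)
(* Mathematical Components, with the real numbers of MathComp-Analysis. *)
From mathcomp Require Import all_boot all_order all_algebra.
From mathcomp Require Import boolp classical_sets reals.

Set Implicit Arguments.
Unset Strict Implicit.
Unset Printing Implicit Defensive.

Import Order.TTheory GRing.Theory Num.Theory.
Local Open Scope ring_scope.

(* Finite directed multigraphs: [edge] is a type of its own, so parallel edges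
   are allowed. *)
Record network := Network {
  vertex : finType;
  edge : finType;
  tail : edge -> vertex;
  head : edge -> vertex;
  source : vertex;
  sink : vertex
}.

Section Paths.
Variable G : network.

Fixpoint walk (u v : vertex G) (p : seq (edge G)) : bool :=
  if p is e :: q then (tail e == u) && walk (head e) v q else u == v.

Definition vertices_from (u : vertex G) (p : seq (edge G)) : seq (vertex G) :=
  u :: [seq head e | e <- p].

(* Paths visit no vertex twice. *)
Definition is_st_path (p : seq (edge G)) : bool :=
  walk (source G) (sink G) p && uniq (vertices_from (source G) p).

(* The length bound only serves to make this a finType: it excludes no path,
   see [size_st_path]. *)
Definition st_path : finType :=
  {p : #|vertex G|.-bseq (edge G) | is_st_path p}.

Definition path_edges (P : st_path) : seq (edge G) := bseqval (sval P).

Definition path_vertices (P : st_path) : seq (vertex G) :=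
  vertices_from (source G) (path_edges P).

Lemma size_st_path (p : seq (edge G)) :
  is_st_path p -> (size p <= #|vertex G|)%N.
Proof.
case/andP=> _ /card_uniqP; rewrite /= size_map => eq_card.
by apply: ltnW; rewrite -[X in (X <= _)%N]eq_card max_card.
Qed.

End Paths.

Section SeriesParallel.

(* Up to isomorphism, a single edge from source to sink. *)
Definition is_single_edge (G : network) : Prop :=
  source G <> sink G /\
  (forall v : vertex G, v = source G \/ v = sink G) /\
  exists e : edge G,
    tail e = source G /\ head e = sink G /\ forall e' : edge G, e' = e.

(* Up to isomorphism, [G] is the disjoint union of [G1] and [G2] in which each
   vertex [u] of [G1] is merged with each vertex [v] of [G2] such that
   [merged u v]; [i1] and [i2] send the vertices of [G1] and [G2] to the vertices
   of [G] they become.  Terminals of [G] are left unspecified. *)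
Definition is_merged_union (G1 G2 G : network)
    (merged : vertex G1 -> vertex G2 -> Prop)
    (i1 : vertex G1 -> vertex G) (i2 : vertex G2 -> vertex G) : Prop :=
  injective i1 /\ injective i2 /\
  (forall u v, i1 u = i2 v <-> merged u v) /\
  (forall w, (exists u, w = i1 u) \/ (exists v, w = i2 v)) /\
  exists j : edge G1 + edge G2 -> edge G,
    bijective j /\
    (forall e, tail (j (inl e)) = i1 (tail e) /\
               head (j (inl e)) = i1 (head e)) /\
    (forall e, tail (j (inr e)) = i2 (tail e) /\
               head (j (inr e)) = i2 (head e)).

Definition is_parallel_composition (G1 G2 G : network) : Prop :=
  exists i1 i2,
    is_merged_union
      (fun (u : vertex G1) (v : vertex G2) =>
         (u = source G1 /\ v = source G2) \/ (u = sink G1 /\ v = sink G2))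
      i1 i2 /\
    source G = i1 (source G1) /\ sink G = i1 (sink G1).

Definition is_serial_composition (G1 G2 G : network) : Prop :=
  exists i1 i2,
    is_merged_union
      (fun (u : vertex G1) (v : vertex G2) => u = sink G1 /\ v = source G2)
      i1 i2 /\
    source G = i1 (source G1) /\ sink G = i2 (sink G2).

(* All edges are created in, and keep, the direction from source to sink. *)
Inductive series_parallel : network -> Prop :=
| SP_edge (G : network) :
    is_single_edge G -> series_parallel G
| SP_parallel (G1 G2 G : network) :
    series_parallel G1 -> series_parallel G2 ->
    is_parallel_composition G1 G2 G -> series_parallel G
| SP_serial (G1 G2 G : network) :
    series_parallel G1 -> series_parallel G2 ->
    is_serial_composition G1 G2 G -> series_parallel G.

End SeriesParallel.

Section Game.
Variables (R : realType) (G : network).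

Definition flow := {ffun st_path G -> R}.

Definition is_path_flow (x : flow) : Prop :=
  (forall P, 0 <= x P) /\ \sum_P x P = 1.

Definition load (x : flow) (e : edge G) : R :=
  \sum_(P : st_path G | e \in path_edges P) x P.

Definition is_distribution (T : finType) (mu : T -> R) : Prop :=
  (forall i, 0 <= mu i) /\ \sum_i mu i = 1.

Variables (a b : edge G -> R).

Definition edge_cost (e : edge G) (y : R) : R := a e * y + b e.

Variables (Theta : finType) (d : Theta -> R).

Definition expected_edge_cost (mu : Theta -> R) (e : edge G) (y : R) : R :=
  \sum_theta mu theta * d theta * edge_cost e (d theta * y).

Definition expected_path_cost (mu : Theta -> R) (x : flow) (P : st_path G) : R :=
  \sum_(e <- path_edges P) expected_edge_cost mu e (load x e).

Definition is_wardrop (mu : Theta -> R) (x : flow) : Prop :=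
  is_path_flow x /\
  forall P Q : st_path G,
    0 < x P -> expected_path_cost mu x P <= expected_path_cost mu x Q.

(* A Wardrop equilibrium for [mu]; all of them have the same edge loads, so the
   choice does not affect [eq_cost]. *)
Definition wardrop_eq (mu : Theta -> R) : flow :=
  xget [ffun=> 0] [set x : flow | is_wardrop mu x]%classic.

Definition eq_cost (mu : Theta -> R) : R :=
  \sum_(e : edge G)
     load (wardrop_eq mu) e * expected_edge_cost mu e (load (wardrop_eq mu) e).

Variable Sigma : finType.

Definition is_scheme (prior : Theta -> R) (phi : Theta -> Sigma -> R) : Prop :=
  (forall theta sigma, 0 <= phi theta sigma) /\
  (forall theta, \sum_sigma phi theta sigma = prior theta).

Definition signal_prob (phi : Theta -> Sigma -> R) (sigma : Sigma) : R :=
  \sum_theta phi theta sigma.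

Definition posterior (phi : Theta -> Sigma -> R) (sigma : Sigma) : Theta -> R :=
  fun theta => phi theta sigma / signal_prob phi sigma.

Definition scheme_cost (phi : Theta -> Sigma -> R) : R :=
  \sum_(sigma | 0 < signal_prob phi sigma)
     signal_prob phi sigma * eq_cost (posterior phi sigma).

Definition is_optimal_scheme (prior : Theta -> R) (phi : Theta -> Sigma -> R) :
    Prop :=
  is_scheme prior phi /\
  forall psi, is_scheme prior psi -> scheme_cost phi <= scheme_cost psi.

(* [own theta] is the individual signal of the state [theta]. *)
Definition full_information (prior : Theta -> R) (own : Theta -> Sigma) :
    Theta -> Sigma -> R :=
  fun theta sigma => if sigma == own theta then prior theta else 0.

End Game.

(* The states are theta_1, ..., theta_l with l = n.+1, here indexed from 0; the
   largest demand is normalized to 1.  The set of signals is any finite set that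
   is large enough to have an individual signal for each state. *)
Definition full_information_always_optimal (R : realType) (G : network) : Prop :=
  forall (a b : edge G -> R) (n : nat) (d : 'I_n.+1 -> R) (prior : 'I_n.+1 -> R)
         (Sigma : finType) (own : 'I_n.+1 -> Sigma),
    (forall e, 0 < a e) ->
    (forall e, 0 <= b e) ->
    0 < d ord0 ->
    (forall i j : 'I_n.+1, (i < j)%N -> d i < d j) ->
    d ord_max = 1 ->
    is_distribution prior ->
    injective own ->
    is_optimal_scheme a b d prior (full_information prior own).

(* Main.v *)
From mathcomp Require Import all_boot all_order all_algebra.
From mathcomp Require Import boolp classical_sets reals.
From mathcomp Require Import topology normedtype derive function_spaces.
From mathcomp Require Import ring lra zify.
Require Import Defs.

Set Implicit Arguments.
Unset Strict Implicit.
Unset Printing Implicit Defensive.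

Import Order.TTheory GRing.Theory Num.Theory.
Local Open Scope ring_scope.

(* With m1 and m2 the first two moments of the demand under mu, a Wardrop
   equilibrium for mu is, after scaling by m2 / m1, one for the costs a_e y + b_e
   at total demand m2 / m1, so C(mu) = m1 * lam(m2 / m1) with lam(r) the
   equilibrium path cost at demand r.  Hence full information is always optimal
   iff lam is always concave.

   Series composition adds the functions lam and parallel composition adds their
   inverses; both preserve concavity of nondecreasing functions.

   Conversely, suppose that in an acyclic subnetwork H, covered by s-t-paths, some
   undirected simple s-t-path uses an arc backwards.  For suitable resistances the
   electric current from s to t then runs against this arc.  Start from an
   equilibrium that uses all of H and raise the demand: the flow changes by a
   multiple of the current until the arc is empty, and from then on lam rises
   faster, by the minimality of the energy of the current.

   If no H has such a path, then the network is acyclic (a maximal H is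
   everything), and it decomposes: unless it splits in parallel or is a single
   edge, the absence of a cut vertex would yield a path using an arc backwards. *)

(** * Existence of equilibria *)

(** Concavity enters through the weights mu_i d_i / m1: they sum to 1 and average the demands d_i to
    m2 / m1, so merging states into one signal compares lam at an average with the average of lam.
    Conversely, two states with a prior inversely proportional to their demands have both weights
    equal to 1/2; one failure of midpoint concavity is therefore enough.

    lam is never defined as a function. It appears as the potential difference between sink and
    source in an edgewise form of equilibrium. This form restricts to the parts of a composition,
    because conservation is tested against potentials that can be taken constant on the other part.

    The obstacle in the converse is that the network is not known to be acyclic. The counterexample
    therefore lives on an acyclic [H], whose topological ranks serve as equilibrium potentials and
    leave room for constants b_e >= 0; edges outside [H] are priced out. Acyclicity of the whole
    network is obtained afterwards, by adding ears to [H] as long as possible. *)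

Section Minimization.
Variable R : realType.
Import numFieldNormedType.Exports ArrowAsProduct.

(** This extracts the first-order condition at a minimum from the values along a segment. *)
Lemma ge0_of_quadratic (D C : R) :
  (forall eps, 0 < eps -> eps <= 1 -> 0 <= eps * D + eps ^+ 2 * C) -> 0 <= D.
Proof.
move=> small; rewrite leNgt; apply/negP=> D0.
have C0 : 0 <= `|C| by exact: normr_ge0.
have CC : C <= `|C| by exact: ler_norm.
have den : 0 < `|C| - D + 1 by lra.
(* For negative [D] this lies in (0, 1] and satisfies [eps * |C| < - D], so the linear term
   outweighs the quadratic one. *)
pose eps := - D / (`|C| - D + 1).
have eps0 : 0 < eps by rewrite divr_gt0 // oppr_gt0.
have eps1 : eps <= 1 by rewrite ler_pdivrMr // mul1r; lra.
have := small _ eps0 eps1.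
have -> : eps * D + eps ^+ 2 * C = eps * (D + eps * C) by ring.
rewrite pmulr_rge0 //.
have epsE : eps * (`|C| - D + 1) = - D by rewrite /eps divfK // gt_eqF.
have : eps * C <= eps * `|C| by rewrite ler_pM2l.
have : 0 < eps * (1 - D) by apply: mulr_gt0 => //; lra.
lra.
Qed.

Lemma continuous_coord (I : finType) (i : I) : continuous (fun u : I -> R => u i).
Proof. exact: (@proj_continuous I (fun=> R^o) i). Qed.

Lemma continuous_sum (I : Type) (T : topologicalType) (r : seq I)
    (f : I -> T -> R) :
  (forall i, continuous (f i)) -> continuous (fun u => \sum_(i <- r) f i u).
Proof.
move=> cf u; apply: (@cvg_big R^o) => [|i _]; last exact: cf.
exact: add_continuous.
Qed.

Lemma continuous_mul (T : topologicalType) (f g : T -> R) :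
  continuous f -> continuous g -> continuous (fun u => f u * g u).
Proof. by move=> cf cg u; apply: (@continuousM R T f g u); [exact: cf | exact: cg]. Qed.

Lemma continuous_scale (T : topologicalType) (c : R) (f : T -> R) :
  continuous f -> continuous (fun u => c * f u).
Proof. by move=> cf; apply: continuous_mul => // u; exact: cvg_cst. Qed.

Lemma continuous_add (T : topologicalType) (f g : T -> R) :
  continuous f -> continuous g -> continuous (fun u => f u + g u).
Proof. by move=> cf cg u; apply: (@continuousD R R^o T f g u); [exact: cf | exact: cg]. Qed.

(** A minimizer of a quadratic energy over a compact polytope exists, and its derivative towards any
    feasible point is nonnegative. Path flows use this for Wardrop equilibria, vertex potentials for
    electric currents. *)
Lemma variational_inequality (I E : finType) (lo hi k : I -> R) (k0 : R)
    (m : E -> I -> R) (al be : E -> R)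
    (feasible := fun u : I -> R =>
       (forall i, lo i <= u i <= hi i) /\ \sum_i k i * u i = k0)
    (l := fun e (u : I -> R) => \sum_i m e i * u i) :
  (exists u, feasible u) ->
  exists2 u, feasible u &
    forall w, feasible w ->
      0 <= \sum_e (al e * l e u + be e) * (l e w - l e u).
Proof.
move=> [u0 feas0].
have c_lin (c : I -> R) : continuous (fun u : I -> R => \sum_i c i * u i).
  by apply: continuous_sum => i; apply: continuous_scale; exact: continuous_coord.
pose F (u : I -> R) := \sum_e (al e * (l e u * l e u) + 2 * be e * l e u).
have cF : continuous F.
  apply: continuous_sum => e; apply: continuous_add.
    by apply: continuous_scale; apply: continuous_mul; exact: c_lin.
  by apply: continuous_scale; exact: c_lin.
pose box := [set u : I -> R | forall i, `[lo i, hi i]%classic (u i)]%classic.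
pose plane := [set u : I -> R | \sum_i k i * u i = k0]%classic.
have cbox : compact box.
  apply: (@tychonoff I (fun=> R^o) (fun i => `[lo i, hi i]%classic)) => i.
  exact: segment_compact.
have cplane : closed plane.
  by apply: (@preimage_closed _ _ (fun u : I -> R => \sum_i k i * u i)
    [set x | x = k0]%classic) => // u _; exact: c_lin.
have feasE u : feasible u <-> (box `&` plane)%classic u.
  by split=> -[ubox uplane]; split=> // i; have := ubox i; rewrite /= in_itv.
have ne : ((box `&` plane) !=set0)%classic by exists u0; apply/feasE.
have [u + umin] := @compact_EVT_min _ R F _ ne (compact_closedI cbox cplane)
  (continuous_subspaceT cF).
rewrite inE => /feasE feasu; exists u => // w feasw.
pose D := \sum_e (al e * l e u + be e) * (l e w - l e u).
pose C := \sum_e al e * (l e w - l e u) ^+ 2.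
suff: 0 <= 2 * D by rewrite pmulr_rge0.
apply: (@ge0_of_quadratic _ C) => eps eps0 eps1.
pose v i := u i + eps * (w i - u i).
have feasv : feasible v.
  split=> [i|]; last first.
    have -> : \sum_i k i * v i =
        \sum_i k i * u i + eps * (\sum_i k i * w i - \sum_i k i * u i).
      rewrite -sumrB mulr_sumr -big_split /=.
      by apply: eq_bigr => i _; rewrite /v; ring.
    by rewrite feasu.2 feasw.2 subrr mulr0 addr0.
  have /andP[ulo uhi] := feasu.1 i; have /andP[wlo whi] := feasw.1 i.
  have conv (x y : R) : 0 <= x -> 0 <= y -> 0 <= (1 - eps) * x + eps * y.
    by move=> x0 y0; apply: addr_ge0; apply: mulr_ge0 => //; lra.
  have := conv (u i - lo i) (w i - lo i); have := conv (hi i - u i) (hi i - w i).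
  rewrite !subr_ge0 /v => /(_ uhi whi) ? /(_ ulo wlo) ?; apply/andP; split; lra.
have /umin : v \in (box `&` plane)%classic by rewrite inE; apply/feasE.
rewrite -subr_ge0; congr (0 <= _).
have lv e : l e v = l e u + eps * (l e w - l e u).
  rewrite /l -sumrB mulr_sumr -big_split /=.
  by apply: eq_bigr => i _; rewrite /v; ring.
rewrite -sumrB /D /C !mulr_sumr -big_split /=.
by apply: eq_bigr => e _; rewrite lv; ring.
Qed.

End Minimization.

(** * Walks, loop erasure and source-sink paths *)

Section Walks.
Variable G : network.
Implicit Types (u v w : vertex G) (e : edge G) (p q : seq (edge G)).

Lemma walk_cat u v p q :
  walk u v (p ++ q) =
  walk u (last u [seq head i | i <- p]) p && walk (last u [seq head i | i <- p]) v q.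
Proof.
elim: p u => [|e p IHp] u /=; first by rewrite eqxx.
by rewrite IHp andbA.
Qed.

Lemma walk_last u v p : walk u v p -> last u [seq head i | i <- p] = v.
Proof. by elim: p u => [|e p IHp] u /= => [/eqP|/andP[_ /IHp]]. Qed.

Lemma walk_split u v p e q :
  walk u v (p ++ e :: q) = walk u (tail e) p && walk (head e) v q.
Proof.
rewrite walk_cat /=; have [->|ne] := eqVneq (tail e) (last u [seq head i | i <- p]).
  by [].
rewrite andbF; case: (boolP (walk u (tail e) p)) => // /walk_last tailE.
by rewrite tailE eqxx in ne.
Qed.

Lemma walk_join u v w p q : walk u v p -> walk v w q -> walk u w (p ++ q).
Proof. by move=> pu qv; rewrite walk_cat (walk_last pu) pu. Qed.

Lemma walk_telescope (V : zmodType) (phi : vertex G -> V) u v p :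
  walk u v p -> \sum_(e <- p) (phi (head e) - phi (tail e)) = phi v - phi u.
Proof.
elim: p u => [|e p IHp] u /=; first by move/eqP->; rewrite big_nil subrr.
by case/andP=> /eqP <- /IHp; rewrite big_cons => ->; rewrite addrC subrKA.
Qed.

Lemma walk_suffix u v w p :
  walk w v p -> u \in vertices_from w p ->
  exists q1 q2 s, [/\ p = q1 ++ q2, walk u v q2 &
    vertices_from w p = s ++ vertices_from u q2].
Proof.
elim: p w => [|e p IHp] w /=.
  rewrite inE => /eqP -> /eqP ->; exists [::], [::], [::]; split=> //=.
case/andP=> /eqP <- wp; rewrite /vertices_from inE => /orP[/eqP->|up].
  by exists [::], (e :: p), [::]; rewrite /= eqxx.
have [q1 [q2 [s [-> uq2 eqs]]]] := IHp _ wp up.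
by exists (e :: q1), q2, (tail e :: s); rewrite /= -eqs.
Qed.

(** The subsequence clause guarantees that erasing loops does not raise the length for nonnegative
    edge costs. *)
Lemma loop_erasure u v p :
  walk u v p ->
  exists q, [/\ walk u v q, uniq (vertices_from u q) & subseq q p].
Proof.
elim: p u => [|e p IHp] u /=; first by move=> uv; exists [::].
case/andP=> /eqP tail_e /IHp[q [wq uq sq]].
have [uin|unotin] := boolP (u \in vertices_from (head e) q).
  have [q1 [q2 [s [qE uq2 eqs]]]] := walk_suffix wq uin.
  exists q2; split=> //; first by move: uq; rewrite eqs cat_uniq => /and3P[].
  apply: subseq_trans (subseq_cons _ _); apply: subseq_trans sq.
  by rewrite qE suffix_subseq.
exists (e :: q); rewrite /= tail_e eqxx wq eqxx; split=> //.
by rewrite /vertices_from /= in unotin *; rewrite unotin.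
Qed.

Lemma st_pathP p : is_st_path p -> exists P : st_path G, path_edges P = p.
Proof.
move=> stp; have szp := size_st_path stp.
have stp' : is_st_path (Bseq szp) by [].
by exists (exist _ (Bseq szp) stp').
Qed.

Lemma path_walk (P : st_path G) : walk (source G) (sink G) (path_edges P).
Proof. by have /andP[] := svalP P. Qed.

Lemma path_uniq (P : st_path G) :
  uniq (vertices_from (source G) (path_edges P)).
Proof. by have /andP[] := svalP P. Qed.

Lemma path_edges_uniq (P : st_path G) : uniq (path_edges P).
Proof. by have := path_uniq P; rewrite /= => /andP[_ /map_uniq]. Qed.

Lemma sum_path_edges (R : pzRingType) (P : st_path G) (F : edge G -> R) :
  \sum_e (e \in path_edges P)%:R * F e = \sum_(e <- path_edges P) F e.
Proof.
rewrite [RHS]big_uniq ?path_edges_uniq // [RHS]big_mkcond /=.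
by apply: eq_bigr => e _; case: (e \in _); rewrite ?mul1r ?mul0r.
Qed.

End Walks.

Lemma ler_sum_subseq (R : numDomainType) (T : eqType) (F : T -> R) s1 s2 :
  (forall x, 0 <= F x) -> subseq s1 s2 ->
  \sum_(x <- s1) F x <= \sum_(x <- s2) F x.
Proof.
move=> F0 /perm_to_subseq[s3 perm]; rewrite (perm_big _ perm) big_cat /=.
by rewrite lerDl sumr_ge0.
Qed.

(** * Edge flows and equilibria with potentials *)

Section Equilibria.
Variables (R : realType) (G : network).

(* [f] ships [r] units from source to sink.  Testing against all vertex
   potentials is conservation at every inner vertex after summation by parts. *)
Definition is_flow (f : edge G -> R) (r : R) : Prop :=
  forall phi : vertex G -> R,
    \sum_e f e * (phi (head e) - phi (tail e)) =
    r * (phi (sink G) - phi (source G)).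

(** Complementary slackness with vertex potentials replaces the comparison of paths, at an arbitrary
    demand [r]. As a condition on single edges it passes to the parts of a composition. *)
Definition is_edge_equilibrium (a b : edge G -> R) (r : R) (f : edge G -> R)
    (pi : vertex G -> R) : Prop :=
  [/\ forall e, 0 <= f e, is_flow f r,
      forall e, pi (head e) - pi (tail e) <= a e * f e + b e &
      forall e, 0 < f e -> pi (head e) - pi (tail e) = a e * f e + b e].

(** Each flow is cheapest for its own edge costs; adding the two comparisons bounds the sum of
    [a e * (f e - f' e) ^+ 2] by 0. The potential difference is then the common total cost divided
    by [r]. *)
Lemma edge_equilibrium_unique (a b : edge G -> R) r f pi f' pi' :
  (forall e, 0 < a e) -> 0 < r ->
  is_edge_equilibrium a b r f pi -> is_edge_equilibrium a b r f' pi' ->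
  pi (sink G) - pi (source G) = pi' (sink G) - pi' (source G).
Proof.
move=> a0 r0 [f0 flf le_pi eq_pi] [f0' flf' le_pi' eq_pi'].
have cost h rho (h0 : forall e, 0 <= h e) (flh : is_flow h r)
    (eqh : forall e, 0 < h e -> rho (head e) - rho (tail e) = a e * h e + b e) :
    \sum_e h e * (a e * h e + b e) = r * (rho (sink G) - rho (source G)).
  rewrite -flh; apply: eq_bigr => e _.
  have := h0 e; rewrite le_eqVlt => /predU1P[<-|/eqh -> //].
  by rewrite !mul0r.
have ge h rho (h0 : forall e, 0 <= h e) (flh : is_flow h r) k
    (leh : forall e, rho (head e) - rho (tail e) <= a e * k e + b e) :
    r * (rho (sink G) - rho (source G)) <= \sum_e h e * (a e * k e + b e).
  by rewrite -flh; apply: ler_sum => e _; apply: ler_wpM2l.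
have ff' : f =1 f'.
  have : \sum_e a e * (f e - f' e) ^+ 2 <= 0.
    have -> : \sum_e a e * (f e - f' e) ^+ 2 =
      (\sum_e f e * (a e * f e + b e) - \sum_e f' e * (a e * f e + b e)) +
      (\sum_e f' e * (a e * f' e + b e) - \sum_e f e * (a e * f' e + b e)).
      rewrite -!sumrB -big_split; apply: eq_bigr => e _ /=; ring.
    rewrite (cost _ _ f0 flf eq_pi) (cost _ _ f0' flf' eq_pi').
    have := ge _ _ f0' flf' _ le_pi; have := ge _ _ f0 flf _ le_pi'; lra.
  have sq0 e : true -> 0 <= a e * (f e - f' e) ^+ 2.
    by rewrite mulr_ge0 ?sqr_ge0 // ltW.
  move=> le0; have /eqP : \sum_e a e * (f e - f' e) ^+ 2 = 0.
    by apply/eqP; rewrite eq_le le0 sumr_ge0.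
  rewrite psumr_eq0 // => /allP all0 e; have := all0 e.
  rewrite mem_index_enum => /(_ isT); rewrite mulf_eq0 gt_eqF //= sqrf_eq0.
  by rewrite subr_eq0 => /eqP.
apply: (mulfI (lt0r_neq0 r0)).
rewrite -(cost _ _ f0 flf eq_pi) -(cost _ _ f0' flf' eq_pi').
by apply: eq_bigr => e _; rewrite ff'.
Qed.

End Equilibria.

Section Loads.
Variables (R : realType) (G : network).
Implicit Types (x : flow R G) (e : edge G).

Lemma is_flow_scale (f : edge G -> R) r k :
  is_flow f r -> is_flow (fun e => k * f e) (k * r).
Proof.
move=> flf phi; rewrite -mulrA -flf mulr_sumr.
by apply: eq_bigr => e _; rewrite mulrA.
Qed.

Lemma loadE x e : load x e = \sum_P (e \in path_edges P)%:R * x P.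
Proof.
rewrite /load big_mkcond /=; apply: eq_bigr => P _.
by case: (e \in _); rewrite ?mul1r ?mul0r.
Qed.

Lemma load_ge0 x e : is_path_flow x -> 0 <= load x e.
Proof. by case=> x0 _; apply: sumr_ge0. Qed.

Lemma sum_load x (F : edge G -> R) :
  \sum_e load x e * F e = \sum_P x P * \sum_(e <- path_edges P) F e.
Proof.
under eq_bigr => e _ do rewrite loadE mulr_suml.
rewrite exchange_big /=; apply: eq_bigr => P _.
rewrite -sum_path_edges mulr_sumr; apply: eq_bigr => e _; ring.
Qed.

Lemma load_is_flow x : is_path_flow x -> is_flow (load x) 1.
Proof.
case=> _ x1 phi; rewrite sum_load.
under eq_bigr => P _ do rewrite (walk_telescope phi (path_walk P)).
by rewrite -mulr_suml x1.
Qed.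

Lemma load_gt0 x e :
  is_path_flow x -> 0 < load x e -> exists2 P, 0 < x P & e \in path_edges P.
Proof.
move=> [x0 _] lt0; have [P /andP[eP xP]|none] :=
  pickP (fun P : st_path G => (e \in path_edges P) && (0 < x P)).
  by exists P.
move: lt0; rewrite /load big1 ?ltxx // => P eP.
have := none P; rewrite eP /= lt_neqAle x0 andbT => /negbFE /eqP //.
Qed.

(* The potential is the distance from the source. *)
Lemma shortest_path_potential x (C : edge G -> R) :
  (forall v : vertex G, exists p, walk (source G) v p) ->
  (forall e, 0 <= C e) -> is_path_flow x ->
  (forall P Q : st_path G, 0 < x P ->
     \sum_(e <- path_edges P) C e <= \sum_(e <- path_edges Q) C e) ->
  exists pi : vertex G -> R,
    (forall e, pi (head e) - pi (tail e) <= C e) /\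
    (forall e, 0 < load x e -> pi (head e) - pi (tail e) = C e).
Proof.
move=> reach C0 flx opt.
pose len p := \sum_(e <- p) C e.
pose S v := [set c : R | exists2 p, walk (source G) v p & c = len p]%classic.
have lbS v : lbound (S v) 0 by move=> _ [p _ ->]; apply: sumr_ge0.
have neS v : (S v !=set0)%classic.
  by have [p wp] := reach v; exists (len p), p.
have infS v p : walk (source G) v p -> inf (S v) <= len p.
  by move=> wp; apply: ge_inf; [exists 0; exact: lbS | exists p].
have le_pi e : inf (S (head e)) - inf (S (tail e)) <= C e.
  rewrite lerBlDr -lerBlDl; apply: lb_le_inf => // _ [p wp ->].
  rewrite lerBlDl; apply: le_trans (infS _ (rcons p e) _) _.
    by rewrite -cats1 walk_split wp /=.
  by rewrite /len -cats1 big_cat big_seq1 addrC.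
exists (fun v => inf (S v)); split=> // e /(load_gt0 flx)[P xP eP].
apply/eqP; rewrite eq_le le_pi /= lerBrDr; apply: lb_le_inf => // _ [q wq ->].
have [p1 [p2 PE]] : exists p1 p2, path_edges P = p1 ++ e :: p2.
  by case/splitPr: eP => p1 p2; exists p1, p2.
have := path_walk P; rewrite PE walk_split => /andP[w1 w2].
(* Replacing the part of [P] up to [e] by [q] gives a walk to the sink; its loop erasure is a path
   that competes with [P]. *)
have [p [wp up sp]] := loop_erasure (walk_join wq w2).
have /st_pathP[Q QE] : is_st_path p by rewrite /is_st_path wp.
have := opt P Q xP; rewrite PE QE => le1.
have := le_trans le1 (ler_sum_subseq C0 sp); rewrite !big_cat big_cons /=.
by have := infS _ _ w1; rewrite /len; lra.
Qed.

End Loads.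

(** * Wardrop equilibria through the moments of the demand *)

Section Wardrop.
Variables (R : realType) (G : network) (a b : edge G -> R).
Variables (Theta : finType) (d mu : Theta -> R).

Definition mean_demand := \sum_i mu i * d i.
Definition mean_square_demand := \sum_i mu i * d i ^+ 2.

Lemma expected_edge_costE e y :
  expected_edge_cost a b d mu e y =
  mean_square_demand * a e * y + mean_demand * b e.
Proof.
rewrite /expected_edge_cost /edge_cost !mulr_suml -big_split /=.
by apply: eq_bigr => i _; ring.
Qed.

Lemma wardrop_exists : st_path G -> exists x, is_wardrop a b d mu x.
Proof.
move=> P0.
pose m (e : edge G) (P : st_path G) : R := (e \in path_edges P)%:R.
have feas0 : exists u : st_path G -> R,
    (forall P, 0 <= u P <= 1) /\ \sum_P 1 * u P = 1.
  exists (fun P => (P == P0)%:R); split=> [P|]; first by case: eqP; rewrite ?lexx ?ler01.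
  rewrite (bigD1 P0) //= eqxx big1 ?mulr1 ?addr0 // => P /negbTE ->.
  by rewrite mulr0.
have [u [u01 u1] vi] := variational_inequality m
  (fun e => mean_square_demand * a e) (fun e => mean_demand * b e) feas0.
pose x : flow R G := [ffun P => u P].
have flx : is_path_flow x.
  split=> [P|]; first by rewrite ffunE; case/andP: (u01 P).
  by rewrite -u1; apply: eq_bigr => P _; rewrite ffunE mul1r.
exists x; split=> // P Q xP.
have [->|QP] := eqVneq Q P; first by [].
(* All flow on [P] is moved to [Q]; the variational inequality in this direction is [u P] times the
   cost difference of the two paths. *)
pose w T := u T + u P * ((T == Q)%:R - (T == P)%:R).
have sum_eq (S T : st_path G) (F : st_path G -> R) :
    \sum_S F S * (S == T)%:R = F T.
  rewrite (bigD1 T) //= eqxx big1 ?mulr1 ?addr0 // => S' /negbTE ->.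
  by rewrite mulr0.
have sumw (F : st_path G -> R) :
    \sum_T F T * w T = \sum_T F T * u T + u P * (F Q - F P).
  rewrite -[F Q](sum_eq Q) -[F P](sum_eq P) -sumrB mulr_sumr -big_split /=.
  by apply: eq_bigr => T _; rewrite /w; ring.
have w0 T : 0 <= w T.
  have /andP[uT _] := u01 T; have /andP[uP _] := u01 P.
  rewrite /w; case: (eqVneq T P) => [->|_].
    by rewrite eq_sym (negbTE QP) mulr0n mulr1n; lra.
  by case: (T == Q); rewrite ?mulr1n mulr0n; lra.
have w1 : \sum_T 1 * w T = 1 by rewrite sumw u1; ring.
have feasw : (forall T, 0 <= w T <= 1) /\ \sum_T 1 * w T = 1.
  split=> // T; rewrite w0 -w1 (bigD1 T) //= mul1r lerDl.
  by apply: sumr_ge0 => S _; rewrite mul1r.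
have := vi _ feasw.
have loadx e : \sum_T m e T * u T = load x e.
  by rewrite loadE; apply: eq_bigr => T _; rewrite ffunE.
under eq_bigr => e _ do rewrite sumw addrAC subrr add0r loadx
  -expected_edge_costE mulrCA mulrBr -[X in _ * (X - _)]mulrC -[X in _ * (_ - X)]mulrC.
rewrite -mulr_sumr sumrB !sum_path_edges pmulr_rge0 ?subr_ge0 //.
by move: xP; rewrite ffunE.
Qed.

Hypotheses (a_gt0 : forall e, 0 < a e) (b_ge0 : forall e, 0 <= b e).
Hypotheses (d_gt0 : forall i, 0 < d i) (mu_distr : is_distribution mu).

Lemma mean_demand_gt0 : 0 < mean_demand.
Proof.
have [mu0 mu1] := mu_distr; rewrite lt_neqAle eq_sym andbC sumr_ge0 /=; last first.
  by move=> i _; rewrite mulr_ge0 // ltW.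
apply/eqP => /eqP; rewrite psumr_eq0 => [/allP all0|i _]; last first.
  by rewrite mulr_ge0 // ltW.
have : \sum_i mu i = 0.
  apply: big1 => i _; have := all0 i; rewrite mem_index_enum => /(_ isT).
  by rewrite mulf_eq0 (gt_eqF (d_gt0 i)) orbF => /eqP.
by rewrite mu1; lra.
Qed.

Lemma mean_square_demand_gt0 : 0 < mean_square_demand.
Proof.
have [mu0 mu1] := mu_distr; rewrite lt_neqAle eq_sym andbC sumr_ge0 /=; last first.
  by move=> i _; rewrite mulr_ge0 // sqr_ge0.
apply/eqP => /eqP; rewrite psumr_eq0 => [/allP all0|i _]; last first.
  by rewrite mulr_ge0 // sqr_ge0.
have : \sum_i mu i = 0.
  apply: big1 => i _; have := all0 i; rewrite mem_index_enum => /(_ isT).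
  by rewrite mulf_eq0 sqrf_eq0 (gt_eqF (d_gt0 i)) orbF => /eqP.
by rewrite mu1; lra.
Qed.

(** Dividing the expected edge cost by the mean demand leaves [a e * (r * load x e) + b e] with [r]
    the ratio of the moments. So loads scale by [r] and potentials by the inverse mean demand. *)
Lemma eq_costE :
  (forall v : vertex G, exists p, walk (source G) v p) ->
  exists f pi,
    is_edge_equilibrium a b (mean_square_demand / mean_demand) f pi /\
    eq_cost a b d mu = mean_demand * (pi (sink G) - pi (source G)).
Proof.
move=> reach; have m1 := mean_demand_gt0; have m2 := mean_square_demand_gt0.
have [p0 wp0] := reach (sink G).
have [q0 [wq0 uq0 _]] := loop_erasure wp0.
have /st_pathP[P0 _] : is_st_path q0 by rewrite /is_st_path wq0.
have : is_wardrop a b d mu (wardrop_eq a b d mu).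
  have [x0 wx0] := wardrop_exists P0.
  exact: (@xgetPex _ _ [set x | is_wardrop a b d mu x]%classic (ex_intro _ _ wx0)).
rewrite /eq_cost; move: (wardrop_eq _ _ _ _) => x [flx opt].
pose C e := expected_edge_cost a b d mu e (load x e).
have load0 e := load_ge0 e flx.
have C0 e : 0 <= C e.
  rewrite /C expected_edge_costE addr_ge0 // !mulr_ge0 //; exact: ltW.
have [pi [le_pi eq_pi]] := shortest_path_potential reach C0 flx opt.
set r := _ / _; have r0 : 0 < r by apply: divr_gt0.
have CE e : C e / mean_demand = a e * (r * load x e) + b e.
  by rewrite /C expected_edge_costE /r; field; rewrite gt_eqF.
exists (fun e => r * load x e), (fun v => pi v / mean_demand); split.
  split=> [e||e|e].
  - by rewrite mulr_ge0 // ltW.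
  - by rewrite -{2}[r]mulr1; apply: is_flow_scale; exact: load_is_flow.
  - by rewrite -CE -mulrBl ler_pM2r ?invr_gt0.
  - by rewrite pmulr_rgt0 // => /eq_pi eqe; rewrite -CE -mulrBl eqe.
rewrite -mulrBl mulrCA mulfV ?gt_eqF // mulr1.
(* The loads ship one unit, so the potential difference is the sum of load times edge difference;
   the latter is the edge cost wherever the load is positive. *)
rewrite -[RHS]mul1r -(load_is_flow flx); apply: eq_bigr => e _.
have := load0 e; rewrite le_eqVlt => /predU1P[<-|/eq_pi -> //].
by rewrite !mul0r.
Qed.

End Wardrop.

(** * Series-parallel networks *)

Section SeriesParallelConcavity.
Variable R : realType.

(** Gluing supplies the test potentials with which flows of a composition are analysed part by
    part. *)
Lemma merged_potential (G1 G2 G : network) merged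
    (i1 : vertex G1 -> vertex G) (i2 : vertex G2 -> vertex G)
    (phi1 : vertex G1 -> R) (phi2 : vertex G2 -> R) :
  is_merged_union merged i1 i2 ->
  (forall u v, merged u v -> phi1 u = phi2 v) ->
  exists phi : vertex G -> R, phi \o i1 =1 phi1 /\ phi \o i2 =1 phi2.
Proof.
move=> [inj1 [inj2 [mergedP [cover _]]]] compat.
have /choice[phi phiP] : forall w, exists c : R,
    (forall u, w = i1 u -> c = phi1 u) /\ (forall v, w = i2 v -> c = phi2 v).
  move=> w; have [[u ->]|[v ->]] := cover w.
    exists (phi1 u); split=> [u' /inj1 -> //|v' /mergedP /compat //].
  exists (phi2 v); split=> [u' eq_v|v' /inj2 -> //].
  by symmetry; apply: compat; apply/mergedP.
by exists phi; split=> u; [exact: (phiP (i1 u)).1 | exact: (phiP (i2 u)).2].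
Qed.

Lemma sum_merged (G1 G2 G : network) merged
    (i1 : vertex G1 -> vertex G) (i2 : vertex G2 -> vertex G) :
  is_merged_union merged i1 i2 ->
  exists j : edge G1 + edge G2 -> edge G,
    (forall e, tail (j (inl e)) = i1 (tail e) /\
               head (j (inl e)) = i1 (head e)) /\
    (forall e, tail (j (inr e)) = i2 (tail e) /\
               head (j (inr e)) = i2 (head e)) /\
    (forall e, (exists e1, e = j (inl e1)) \/ (exists e2, e = j (inr e2))) /\
    forall F : edge G -> R,
      \sum_e F e = \sum_e F (j (inl e)) + \sum_e F (j (inr e)).
Proof.
move=> [_ [_ [_ [_ [j [bij_j [j1 j2]]]]]]]; exists j; split=> //; split=> //.
have [k _ jK] := bij_j; split.
  by move=> e; rewrite -[e]jK; case: (k e) => e'; [left | right]; exists e'.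
move=> F; rewrite (reindex j) /=; last exact: onW_bij.
exact: big_sumType.
Qed.

Lemma merged_flow (G1 G2 G : network) merged i1 i2 (f : edge G -> R) r
    (j : edge G1 + edge G2 -> edge G) (phi1 : vertex G1 -> R)
    (phi2 : vertex G2 -> R) :
  is_merged_union merged i1 i2 ->
  (forall e, tail (j (inl e)) = i1 (tail e) /\
             head (j (inl e)) = i1 (head e)) ->
  (forall e, tail (j (inr e)) = i2 (tail e) /\
             head (j (inr e)) = i2 (head e)) ->
  (forall F : edge G -> R,
      \sum_e F e = \sum_e F (j (inl e)) + \sum_e F (j (inr e))) ->
  (forall u v, merged u v -> phi1 u = phi2 v) ->
  is_flow f r ->
  exists phi : vertex G -> R, [/\ phi \o i1 =1 phi1, phi \o i2 =1 phi2 &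
    \sum_e f (j (inl e)) * (phi1 (head e) - phi1 (tail e)) +
    \sum_e f (j (inr e)) * (phi2 (head e) - phi2 (tail e)) =
    r * (phi (sink G) - phi (source G))].
Proof.
move=> mu j1 j2 sumj compat flf; have [phi [phi1E phi2E]] := merged_potential mu compat.
exists phi; split=> //; rewrite -flf sumj; congr (_ + _); apply: eq_bigr => e _.
  by have [-> ->] := j1 e; rewrite -!phi1E.
by have [-> ->] := j2 e; rewrite -!phi2E.
Qed.

(** Tested against such a potential, a nonnegative flow shows a nonnegative value. Parallel
    composition needs this, as it yields the demands of the parts without their signs. *)
Lemma sp_monotone_potential (G : network) :
  series_parallel G ->
  exists psi : vertex G -> R,
    [/\ psi (source G) = 0, psi (sink G) = 1 &
        forall e, psi (tail e) <= psi (head e)].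
Proof.
elim=> {G} [G [st [_ [e0 [te [he all_e]]]]]
          |G1 G2 G _ [psi1 [s1 t1 m1]] _ [psi2 [s2 t2 m2]] [i1 [i2 [mu [sE tE]]]]
          |G1 G2 G _ [psi1 [s1 t1 m1]] _ [psi2 [s2 t2 m2]] [i1 [i2 [mu [sE tE]]]]].
- exists (fun v => (v == sink G)%:R); rewrite eqxx; split=> // [|e].
    by move/eqP/negbTE: st => ->.
  by rewrite (all_e e) te he eqxx; move/eqP/negbTE: st => ->.
- have [j [j1 [j2 [jcov _]]]] := sum_merged mu.
  have [u v|psi [E1 E2]] := @merged_potential _ _ _ _ _ _ psi1 psi2 mu.
    by case=> -[-> ->]; rewrite ?s1 ?t1 ?s2 ?t2.
  exists psi; rewrite sE tE -[psi _]/((psi \o i1) _) -[psi (i1 (sink _))]/((psi \o i1) _).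
  rewrite !E1; split=> // e; have [[e1 ->]|[e2 ->]] := jcov e.
    have [-> ->] := j1 e1.
    by have := m1 e1; rewrite -!E1.
  have [-> ->] := j2 e2.
  by have := m2 e2; rewrite -!E2.
have [j [j1 [j2 [jcov _]]]] := sum_merged mu.
(* In series the whole rise from 0 to 1 is placed in the first part. *)
have [u v|psi [E1 E2]] := @merged_potential _ _ _ _ _ _ psi1 (fun=> 1) mu.
  by case=> -> _; rewrite t1.
exists psi; rewrite sE tE -[psi (i1 _)]/((psi \o i1) _) -[psi (i2 _)]/((psi \o i2) _).
rewrite E1 E2; split=> // e; have [[e1 ->]|[e2 ->]] := jcov e.
  have [-> ->] := j1 e1.
  by have := m1 e1; rewrite -!E1.
have [-> ->] := j2 e2.
by rewrite -[psi (i2 (tail _))]/((psi \o i2) _) -[psi (i2 (head _))]/((psi \o i2) _) !E2.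
Qed.

Lemma sp_flow_ge0 (G : network) (f : edge G -> R) r :
  series_parallel G -> (forall e, 0 <= f e) -> is_flow f r -> 0 <= r.
Proof.
move=> /sp_monotone_potential[psi [s0 t1 mono]] f0 flf.
have := flf psi; rewrite s0 t1 subr0 mulr1 => <-.
by apply: sumr_ge0 => e _; rewrite mulr_ge0 // subr_ge0.
Qed.

(** The embeddings are chosen before the equilibrium, so that several equilibria of one network
    restrict to the same costs on the parts. *)
Lemma restrict_parallel (G1 G2 G : network) :
  is_parallel_composition G1 G2 G ->
  exists i1 i2 (j : edge G1 + edge G2 -> edge G),
    forall a b r f (pi : vertex G -> R), is_edge_equilibrium a b r f pi ->
    exists r1 r2, [/\ r = r1 + r2,
      is_edge_equilibrium (a \o j \o inl) (b \o j \o inl) r1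
        (f \o j \o inl) (pi \o i1),
      is_edge_equilibrium (a \o j \o inr) (b \o j \o inr) r2
        (f \o j \o inr) (pi \o i2) &
      [/\ pi (i1 (source G1)) = pi (source G), pi (i1 (sink G1)) = pi (sink G),
          pi (i2 (source G2)) = pi (source G) &
          pi (i2 (sink G2)) = pi (sink G)]].
Proof.
move=> [i1 [i2 [mu [sE tE]]]]; have [j [j1 [j2 [_ sumj]]]] := sum_merged mu.
exists i1, i2, j => a b r f pi [f0 flf le_pi eq_pi].
have [_ [_ [mergedP _]]] := mu.
have s2E : i1 (source G1) = i2 (source G2) by apply/mergedP; left.
have t2E : i1 (sink G1) = i2 (sink G2) by apply/mergedP; right.
pose flow1 phi := \sum_e f (j (inl e)) * (phi (head e) - phi (tail e)).
pose flow2 phi := \sum_e f (j (inr e)) * (phi (head e) - phi (tail e)).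
have total phi1 phi2 : phi1 (source G1) = phi2 (source G2) ->
    phi1 (sink G1) = phi2 (sink G2) ->
    flow1 phi1 + flow2 phi2 = r * (phi1 (sink G1) - phi1 (source G1)).
  move=> es et; have compat u v : (u = source G1 /\ v = source G2) \/
      (u = sink G1 /\ v = sink G2) -> phi1 u = phi2 v by case=> -[-> ->].
  have [phi [E1 E2 ->]] := merged_flow mu j1 j2 sumj compat flf.
  by rewrite sE tE -!E1.
(* If the terminals of a part coincide, every potential difference between them is 0 and the split
   of [r] is arbitrary. *)
have [st1|ne1] := eqVneq (source G1) (sink G1).
  have st2 : source G2 = sink G2.
    by have [_ [inj2 _]] := mu; apply: inj2; rewrite -s2E -t2E st1.
  exists r, 0; rewrite addr0; split=> //; first split=> //.
  - by move=> e; apply: f0.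
  - move=> phi; have := total phi (fun=> phi (source G1)).
    rewrite /flow2 big1 ?addr0 => [|e _]; last by rewrite subrr mulr0.
    by apply=> //; rewrite st1.
  - by move=> e /=; have := le_pi (j (inl e)); have [-> ->] := j1 e.
  - by move=> e /= /eq_pi; have [-> ->] := j1 e.
  - split=> [e|phi|e|e /= /eq_pi] //=.
    + have := total (fun=> phi (source G2)) phi.
      rewrite /flow1 big1 ?add0r => [|e _]; last by rewrite subrr mulr0.
      by rewrite subrr mulr0 mul0r; apply=> //; rewrite st2.
    + by have := le_pi (j (inr e)); have [-> ->] := j2 e.
    + by have [-> ->] := j2 e.
  - by rewrite -s2E -t2E sE tE.
have ne2 : source G2 != sink G2.
  apply: contra ne1 => /eqP st2; have [inj1 _] := mu.
  by apply/eqP/inj1; rewrite s2E t2E st2.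
(* Such a potential extends any terminal values to the other part. Testing with it there measures
   the net flow into the sink, which defines [r2]. *)
pose jump (G' : network) (c dc : R) (v : vertex G') := c + dc * (v == sink G')%:R.
pose r2 := flow2 (jump G2 0 1).
have fl1 phi : flow1 phi = (r - r2) * (phi (sink G1) - phi (source G1)).
  have := total phi (jump G2 (phi (source G1)) (phi (sink G1) - phi (source G1))).
  rewrite /jump (negbTE ne2) eqxx mulr0 mulr1 addr0 addrC subrK => /(_ erefl erefl).
  have -> : flow2 (fun v => phi (source G1) + (phi (sink G1) - phi (source G1)) *
      (v == sink G2)%:R) = (phi (sink G1) - phi (source G1)) * r2.
    by rewrite /flow2 /r2 mulr_sumr; apply: eq_bigr => e _; rewrite /jump; ring.
  lra.
have fl2 phi : flow2 phi = r2 * (phi (sink G2) - phi (source G2)).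
  have := total (jump G1 (phi (source G2)) (phi (sink G2) - phi (source G2))) phi.
  rewrite fl1 /jump (negbTE ne1) eqxx mulr0 mulr1 addr0 addrC subrK.
  by move=> /(_ erefl erefl); lra.
exists (r - r2), r2; split.
- by rewrite subrK.
- split=> [e|phi|e|e /= /eq_pi] //=; first exact: fl1.
    by have := le_pi (j (inl e)); have [-> ->] := j1 e.
  by have [-> ->] := j1 e.
- split=> [e|phi|e|e /= /eq_pi] //=; first exact: fl2.
    by have := le_pi (j (inr e)); have [-> ->] := j2 e.
  by have [-> ->] := j2 e.
- by rewrite -s2E -t2E sE tE.
Qed.

(** A potential on one part, continued by a constant on the other, tests the flow of that part
    alone; hence both parts carry the full demand. *)
Lemma restrict_serial (G1 G2 G : network) :
  is_serial_composition G1 G2 G ->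
  exists i1 i2 (j : edge G1 + edge G2 -> edge G),
    forall a b r f (pi : vertex G -> R), is_edge_equilibrium a b r f pi ->
    [/\ is_edge_equilibrium (a \o j \o inl) (b \o j \o inl) r
          (f \o j \o inl) (pi \o i1),
        is_edge_equilibrium (a \o j \o inr) (b \o j \o inr) r
          (f \o j \o inr) (pi \o i2),
        pi (i1 (source G1)) = pi (source G), pi (i2 (sink G2)) = pi (sink G) &
        pi (i1 (sink G1)) = pi (i2 (source G2))].
Proof.
move=> [i1 [i2 [mu [sE tE]]]]; have [j [j1 [j2 [_ sumj]]]] := sum_merged mu.
exists i1, i2, j => a b r f pi [f0 flf le_pi eq_pi].
have [_ [_ [mergedP _]]] := mu.
have mid : i1 (sink G1) = i2 (source G2) by apply/mergedP.
have total phi1 phi2 : phi1 (sink G1) = phi2 (source G2) ->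
    \sum_e f (j (inl e)) * (phi1 (head e) - phi1 (tail e)) +
    \sum_e f (j (inr e)) * (phi2 (head e) - phi2 (tail e)) =
    r * (phi2 (sink G2) - phi1 (source G1)).
  move=> em; have compat u v : u = sink G1 /\ v = source G2 -> phi1 u = phi2 v.
    by case=> -> ->.
  have [phi [E1 E2 ->]] := merged_flow mu j1 j2 sumj compat flf.
  by rewrite sE tE -E1 -E2.
split; rewrite ?sE ?tE ?mid //.
- split=> [e|phi|e|e /= /eq_pi] //=.
  + have := total phi (fun=> phi (sink G1)) erefl.
    by rewrite [X in _ + X = _]big1 ?addr0 // => e _; rewrite subrr mulr0.
  + by have := le_pi (j (inl e)); have [-> ->] := j1 e.
  + by have [-> ->] := j1 e.
- split=> [e|phi|e|e /= /eq_pi] //=.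
  + have := total (fun=> phi (source G2)) phi erefl.
    by rewrite [X in X + _ = _]big1 ?add0r // => e _; rewrite subrr mulr0.
  + by have := le_pi (j (inr e)); have [-> ->] := j2 e.
  + by have [-> ->] := j2 e.
Qed.

(* Comparing [r] with the average demand by an inequality builds monotonicity of
   the equilibrium cost into the induction, as parallel composition needs. *)
Lemma sp_concave (G : network) (I : finType) (w : I -> R) :
  series_parallel G -> (forall i, 0 <= w i) -> \sum_i w i = 1 ->
  forall (a b : edge G -> R) r f pi (rs : I -> R) fs pis,
    (forall e, 0 < a e) ->
    is_edge_equilibrium a b r f pi ->
    (forall i, is_edge_equilibrium a b (rs i) (fs i) (pis i)) ->
    0 < r -> \sum_i w i * rs i <= r ->
    \sum_i w i * (pis i (sink G) - pis i (source G)) <=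
    pi (sink G) - pi (source G).
Proof.
move=> spG w0 w1; elim: spG => {G} [G [st [_ [e0 [te [he all_e]]]]]
          |G1 G2 G sp1 IH1 sp2 IH2 /restrict_parallel[i1 [i2 [j restr]]]
          |G1 G2 G sp1 IH1 sp2 IH2 /restrict_serial[i1 [i2 [j restr]]]]
  a b r f pi rs fs pis a0 eqf eqfs r0 le_r.
- have fE g k : is_flow g k -> g e0 = k.
    move=> /(_ (fun v => (v == sink G)%:R)).
    rewrite (bigD1 e0) //= big1 ?addr0 => [|e /eqP ne]; last by case: (ne (all_e e)).
    move/eqP/negbTE: st => st.
    by rewrite te he eqxx st mulr0n mulr1n subr0 !mulr1.
  have [_ /fE fe _ /(_ e0)] := eqf; rewrite fe te he => /(_ r0) ->.
  apply: (@le_trans _ _ (\sum_i w i * (a e0 * rs i + b e0))).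
    apply: ler_sum => i _; apply: ler_wpM2l => //.
    by have [_ /fE <- /(_ e0) + _] := eqfs i; rewrite te he.
  have -> : \sum_i w i * (a e0 * rs i + b e0) =
      a e0 * (\sum_i w i * rs i) + b e0 * (\sum_i w i).
    by rewrite !mulr_sumr -big_split; apply: eq_bigr => i _ /=; ring.
  by rewrite w1 mulr1 lerD2r ler_pM2l.
- have [r1 [r2 [rE eq1 eq2 [ps1 pt1 ps2 pt2]]]] := restr _ _ _ _ _ eqf.
  have /choice[rs1 /choice[rs2 eqs]] := fun i => restr _ _ _ _ _ (eqfs i).
  have r1_ge0 : 0 <= r1 by have [f0 flf _ _] := eq1; exact: sp_flow_ge0 flf.
  have r2_ge0 : 0 <= r2 by have [f0 flf _ _] := eq2; exact: sp_flow_ge0 flf.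
  have s1_ge0 : 0 <= \sum_i w i * rs1 i.
    apply: sumr_ge0 => i _; apply: mulr_ge0 => //.
    by have [_ [f0 flf _ _] _ _] := eqs i; exact: sp_flow_ge0 flf.
  have s2_ge0 : 0 <= \sum_i w i * rs2 i.
    apply: sumr_ge0 => i _; apply: mulr_ge0 => //.
    by have [_ _ [f0 flf _ _] _] := eqs i; exact: sp_flow_ge0 flf.
  have : \sum_i w i * rs1 i + \sum_i w i * rs2 i <= r1 + r2.
    rewrite -rE -big_split; apply: le_trans le_r; apply: ler_sum => i _.
    by have [-> _ _ _] := eqs i; rewrite /= mulrDr.
  (* Both parts have the same potential difference, so treating one of them suffices. All four
     numbers are nonnegative and [r1 + r2] is positive, so in some part a positive demand bounds the
     average. *)
  move=> le12; have [[c1 p1]|[c2 p2]] :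
      (\sum_i w i * rs1 i <= r1 /\ 0 < r1) \/ (\sum_i w i * rs2 i <= r2 /\ 0 < r2).
    have [lt1|ge1] := ltP r1 (\sum_i w i * rs1 i); first by right; lra.
    have [p1|np1] := ltP 0 r1; first by left.
    by right; lra.
  + have := IH1 _ _ _ _ _ rs1 (fun i => fs i \o j \o inl) (fun i => pis i \o i1)
      _ eq1 _ p1 c1.
    rewrite /= ps1 pt1 => IH; apply: le_trans (IH _ _) => [|e|i].
    * apply: ler_sum => i _; have [_ _ _ [-> -> _ _]] := eqs i; exact: lexx.
    * exact: a0.
    * by have [_ ? _ _] := eqs i.
  + have := IH2 _ _ _ _ _ rs2 (fun i => fs i \o j \o inr) (fun i => pis i \o i2)
      _ eq2 _ p2 c2.
    rewrite /= ps2 pt2 => IH; apply: le_trans (IH _ _) => [|e|i].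
    * apply: ler_sum => i _; have [_ _ _ [_ _ -> ->]] := eqs i; exact: lexx.
    * exact: a0.
    * by have [_ _ ? _] := eqs i.
- have [eq1 eq2 ps pt pm] := restr _ _ _ _ _ eqf.
  have eqs i := restr _ _ _ _ _ (eqfs i).
  have := IH1 _ _ _ _ _ rs (fun i => fs i \o j \o inl) (fun i => pis i \o i1)
    _ eq1 _ r0 le_r.
  have := IH2 _ _ _ _ _ rs (fun i => fs i \o j \o inr) (fun i => pis i \o i2)
    _ eq2 _ r0 le_r.
  rewrite /= ps pt pm => h2 h1.
  have := lerD (h1 (fun e => a0 _) (fun i => let: And5 h _ _ _ _ := eqs i in h))
    (h2 (fun e => a0 _) (fun i => let: And5 _ h _ _ _ := eqs i in h)).
  rewrite -big_split /=; set lhs := (X in X <= _); set rhs := (X in _ <= X -> _).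
  have -> : rhs = pi (sink G) - pi (source G) by rewrite /rhs; ring.
  apply: le_trans; apply: ler_sum => i _; have [_ _ -> -> ->] := eqs i.
  by rewrite -mulrDr; apply: ler_wpM2l => //; lra.
Qed.

End SeriesParallelConcavity.

(** * From signaling schemes to concavity of the equilibrium cost *)

Section Signaling.
Variables (R : realType) (G : network) (a b : edge G -> R).
Variables (Theta : finType) (d : Theta -> R).

Definition dirac_at (i : Theta) : Theta -> R := fun k => (k == i)%:R.

Lemma sum_dirac_at i (F : Theta -> R) : \sum_k dirac_at i k * F k = F i.
Proof.
rewrite (bigD1 i) //= /dirac_at eqxx mul1r big1 ?addr0 // => k /negbTE ->.
by rewrite mul0r.
Qed.

Lemma dirac_at_distribution i : is_distribution (dirac_at i).
Proof.
split=> [k|]; first by rewrite ler0n.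
by rewrite -[RHS](sum_dirac_at i (fun=> 1)); apply: eq_bigr => k _; rewrite mulr1.
Qed.

Lemma full_information_scheme (Sigma : finType) (prior : Theta -> R)
    (own : Theta -> Sigma) :
  is_distribution prior -> is_scheme prior (full_information prior own).
Proof.
move=> [prior0 _]; split=> [i s|i]; rewrite /full_information.
  by case: eqP.
by rewrite -big_mkcond big_pred1_eq.
Qed.

Lemma full_information_cost (Sigma : finType) (prior : Theta -> R)
    (own : Theta -> Sigma) :
  is_distribution prior -> injective own ->
  scheme_cost a b d (full_information prior own) =
  \sum_i prior i * eq_cost a b d (dirac_at i).
Proof.
move=> [prior0 _] inj_own.
transitivity (\sum_s \sum_i (if s == own i then prior i else 0) *
                     eq_cost a b d (dirac_at i)); last first.
  rewrite exchange_big /=; apply: eq_bigr => i _.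
  by rewrite -mulr_suml -big_mkcond big_pred1_eq.
rewrite /scheme_cost big_mkcond; apply: eq_bigr => s _ /=.
have [[i sE]|none] := pselect (exists i, s = own i); last first.
  have no i : s == own i = false by apply/eqP => sE; apply: none; exists i.
  rewrite [X in 0 < X]big1 ?ltxx => [|i _]; last by rewrite /full_information no.
  by rewrite big1 // => i _; rewrite no mul0r.
have sk k : s == own k = (k == i) by rewrite sE eq_sym inj_eq.
have probE : signal_prob (full_information prior own) s = prior i.
  rewrite /signal_prob (bigD1 i) //= big1 ?addr0 => [|k /negbTE ki].
    by rewrite /full_information sk eqxx.
  by rewrite /full_information sk ki.
rewrite probE [RHS](bigD1 i) //= sk eqxx big1 ?addr0 => [|k /negbTE ki]; last first.
  by rewrite sk ki mul0r.
case: ifPn => [p0|]; last first.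
  by rewrite lt_neqAle prior0 andbT negbK => /eqP <-; rewrite mul0r.
congr (_ * eq_cost _ _ _ _); apply/funext => k; rewrite /posterior probE.
rewrite /full_information sk /dirac_at; case: eqP => [->|_]; last by rewrite mul0r.
by rewrite mulfV // gt_eqF.
Qed.

Lemma dirac_at_mean i :
  mean_demand d (dirac_at i) = d i /\ mean_square_demand d (dirac_at i) = d i ^+ 2.
Proof. by rewrite /mean_demand /mean_square_demand !sum_dirac_at. Qed.

End Signaling.

(** Jensen's inequality is applied signal by signal. *)
Lemma sp_full_information_optimal (R : realType) (G : network) :
  (forall v : vertex G, exists p, walk (source G) v p) ->
  series_parallel G -> full_information_always_optimal R G.
Proof.
move=> reach spG a b n d prior Sigma own a0 b0 d0 d_inc _ distr inj_own.
have d_gt0 i : 0 < d i.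
  case: (posnP i) => [i0|ip]; first by rewrite (_ : i = ord0) //; apply: val_inj.
  by apply: lt_trans d0 _; apply: d_inc.
have eqs i := eq_costE a0 b0 d_gt0 (dirac_at_distribution R i) reach.
have /choice[fs /choice[pis {}eqs]] := eqs.
pose lam i := pis i (sink G) - pis i (source G).
have fullE i : eq_cost a b d (dirac_at R i) = d i * lam i.
  by have [_ ->] := eqs i; have [-> _] := dirac_at_mean d i.
have {}eqs i : is_edge_equilibrium a b (d i) (fs i) (pis i).
  have [+ _] := eqs i; have [-> ->] := dirac_at_mean d i.
  by rewrite expr2 mulfK // gt_eqF.
split=> [|psi [psi0 psi_prior]]; first exact: full_information_scheme.
rewrite full_information_cost // /scheme_cost.
(* The cost of full information is distributed over the signals of [psi], whose marginals are the
   prior. *)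
under eq_bigr => i _ do rewrite fullE -psi_prior mulr_suml.
rewrite exchange_big /= [leRHS]big_mkcond /=; apply: ler_sum => s _.
case: ifPn => [p0|]; last first.
  rewrite lt_neqAle sumr_ge0 // andbT negbK eq_sym psumr_eq0 // => /allP all0.
  rewrite big1 // => i _; have := all0 i; rewrite mem_index_enum => /(_ isT) /eqP ->.
  by rewrite mul0r.
have post : is_distribution (posterior psi s).
  split=> [i|]; first by rewrite divr_ge0 // ltW.
  by rewrite -mulr_suml mulfV // gt_eqF.
have [f [pi [eqf ->]]] := eq_costE a0 b0 d_gt0 post reach.
have m1 := mean_demand_gt0 d_gt0 post; have m2 := mean_square_demand_gt0 d_gt0 post.
set m := mean_demand _ _ in m1 eqf *.
have neq0 : m != 0 by rewrite gt_eqF.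
(* The demand-weighted posterior has total weight 1, and its mean demand is exactly the ratio of
   second to first moment. *)
have le : \sum_i posterior psi s i * d i / m * (pis i (sink G) - pis i (source G))
    <= pi (sink G) - pi (source G).
  apply: (sp_concave (w := fun i => posterior psi s i * d i / m) spG _ _ a0 eqf eqs).
  - move=> i; apply: divr_ge0; last exact: ltW.
    by apply: mulr_ge0; [case: post | exact: ltW].
  - by rewrite -mulr_suml mulfV.
  - exact: divr_gt0.
  - rewrite /mean_square_demand mulr_suml; apply: ler_sum => i _.
    by rewrite le_eqVlt; apply/orP; left; apply/eqP; field.
have -> : \sum_i psi i s * (d i * lam i) = signal_prob psi s * (m *
    \sum_i posterior psi s i * d i / m * (pis i (sink G) - pis i (source G))).
  rewrite !mulr_sumr; apply: eq_bigr => i _; rewrite /posterior /lam.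
  by field; rewrite neq0 gt_eqF.
by rewrite ler_pM2l // ler_pM2l.
Qed.

(** Comparing full information with no information, for two states of demands [r0] and 1, gives
    midpoint concavity. *)
Lemma full_information_midpoint (R : realType) (G : network) (a b : edge G -> R)
    (r0 : R) f0 pi0 f1 pi1 f2 pi2 :
  full_information_always_optimal R G ->
  (forall v : vertex G, exists p, walk (source G) v p) ->
  (forall e, 0 < a e) -> (forall e, 0 <= b e) -> 0 < r0 -> r0 < 1 ->
  is_edge_equilibrium a b r0 f0 pi0 ->
  is_edge_equilibrium a b ((r0 + 1) / 2) f1 pi1 ->
  is_edge_equilibrium a b 1 f2 pi2 ->
  (pi0 (sink G) - pi0 (source G)) + (pi2 (sink G) - pi2 (source G)) <=
  2 * (pi1 (sink G) - pi1 (source G)).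
Proof.
move=> opt reach a0 b0 r0_gt0 r0_lt1 eq0 eq1 eq2.
have r1 : 0 < 1 + r0 by lra.
have ne1 : 1 + r0 != 0 by rewrite gt_eqF.
pose d (i : 'I_2) : R := if i == ord0 then r0 else 1.
(* Weights inverse to the demands: probability times demand is the same in both states, so the ratio
   of the moments is the midpoint [(r0 + 1) / 2]. *)
pose prior (i : 'I_2) : R := if i == ord0 then 1 / (1 + r0) else r0 / (1 + r0).
have d_gt0 i : 0 < d i by rewrite /d; case: ifP.
have sum2 (F : 'I_2 -> R) : \sum_i F i = F ord0 + F ord_max.
  by rewrite big_ord_recl big_ord1; congr (_ + F _); apply: val_inj.
have distr : is_distribution prior.
  split=> [i|]; last by rewrite sum2 /prior /=; field.
  by rewrite /prior; case: ifP => _; rewrite divr_ge0 //; apply: ltW.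
have costE i f pi : is_edge_equilibrium a b (d i) f pi ->
    eq_cost a b d (dirac_at R i) = d i * (pi (sink G) - pi (source G)).
  move=> eqf; have [f' [pi' [eqf' ->]]] :=
    eq_costE a0 b0 d_gt0 (dirac_at_distribution R i) reach.
  move: eqf'; have [-> ->] := dirac_at_mean d i.
  rewrite expr2 mulfK ?gt_eqF // => eqf'; congr (_ * _).
  exact: edge_equilibrium_unique eqf' eqf.
have d_inc (i j : 'I_2) : (i < j)%N -> d i < d j.
  by case: i j => [[|[|i]] ?] [[|[|j]] ?].
have opt2 : is_optimal_scheme a b d prior (full_information prior id).
  exact: opt.
pose psi (i s : 'I_2) := if s == ord0 then prior i else 0.
have psi_scheme : is_scheme prior psi.
  split=> [i s|i]; first by rewrite /psi; case: ifP => // _; case: distr.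
  by rewrite sum2 /psi /= addr0.
have [_ /(_ psi psi_scheme)] := opt2; rewrite full_information_cost //.
have probE : signal_prob psi ord0 = 1.
  by have [_ <-] := distr; apply: eq_bigr => i _; rewrite /psi eqxx.
have -> : scheme_cost a b d psi = eq_cost a b d prior.
  rewrite /scheme_cost big_mkcond sum2 probE ltr01 mul1r.
  have -> : signal_prob psi ord_max = 0 by apply: big1.
  rewrite ltxx addr0; congr eq_cost; apply/funext => i.
  by rewrite /posterior probE divr1.
have [f [pi [eqf ->]]] := eq_costE a0 b0 d_gt0 distr reach.
have m1E : mean_demand d prior = 2 * r0 / (1 + r0).
  by rewrite /mean_demand sum2 /prior /d /=; field.
have m2E : mean_square_demand d prior = r0.
  by rewrite /mean_square_demand sum2 /prior /d /=; field.
move: eqf; rewrite m1E m2E.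
have -> : r0 / (2 * r0 / (1 + r0)) = (r0 + 1) / 2.
  by field; rewrite ne1 gt_eqF.
move=> eqf; rewrite (edge_equilibrium_unique a0 _ eqf eq1); last lra.
rewrite sum2 (costE ord0 _ _ eq0) (costE ord_max _ _ eq2) /prior /d /=.
set x := pi0 _ - _; set y := pi2 _ - _; set z := pi1 _ - _.
have -> : 1 / (1 + r0) * (r0 * x) + r0 / (1 + r0) * (1 * y) =
  (r0 / (1 + r0)) * (x + y) by ring.
have -> : 2 * r0 / (1 + r0) * z = (r0 / (1 + r0)) * (2 * z) by ring.
by rewrite ler_pM2l // divr_gt0.
Qed.

(** * Reversals and non-concave costs *)

Section Arcs.
Variable G : network.
Implicit Types (H : {set edge G}) (S : {set vertex G}) (u v : vertex G).

Definition arc H : rel (vertex G) :=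
  fun u v => [exists e in H, (tail e == u) && (head e == v)].

Definition adj H : rel (vertex G) := fun u v => arc H u v || arc H v u.

Definition adj_in H S : rel (vertex G) :=
  fun u v => [&& u \in S, v \in S & adj H u v].

(** Acyclicity is encoded by an explicit topological ranking, because the ranks are reused as
    potentials in the counterexample and as positions on paths in the decomposition. *)
Definition increasing H (p : vertex G -> nat) : Prop :=
  forall e, e \in H -> (p (tail e) < p (head e))%N.

Definition spanned H u v : Prop :=
  forall e, e \in H ->
    connect (arc H) u (tail e) /\ connect (arc H) (head e) v.

(* An undirected simple path from [u] to [v] in [H] that traverses an arc
   from [y] to [x] against its direction, given by the vertex sets [S1] and [S2]
   of its parts before and after this arc. *)
Definition has_reversal H u v : Prop :=
  exists (S1 S2 : {set vertex G}) (x y : vertex G),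
    [/\ [disjoint S1 & S2], [/\ u \in S1, x \in S1, y \in S2 & v \in S2],
        arc H y x, connect (adj_in H S1) u x & connect (adj_in H S2) y v].

Lemma arcP H u v :
  reflect (exists e, [/\ e \in H, tail e = u & head e = v]) (arc H u v).
Proof.
apply: (iffP exists_inP) => [[e eH /andP[/eqP ? /eqP ?]]|[e [eH <- <-]]].
  by exists e.
by exists e => //; rewrite !eqxx.
Qed.

Lemma arc_edge H e : e \in H -> arc H (tail e) (head e).
Proof. by move=> eH; apply/arcP; exists e. Qed.

Lemma connect_walk H u v :
  connect (arc H) u v -> exists2 p, walk u v p & {subset p <= H}.
Proof.
case/connectP=> q; elim: q u => [|w q IHq] u /=.
  by move=> _ ->; exists [::]; rewrite /= ?eqxx.
case/andP=> /arcP[e [eH te he]] /IHq/[apply] -[p wp pH].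
exists (e :: p); first by rewrite /= te he eqxx.
by move=> e'; rewrite inE => /predU1P[->|/pH].
Qed.

End Arcs.

(** * Electric currents that run against an arc *)

Section Electric.
Variables (R : realType) (G : network).

(** Dirichlet's principle: [pi] minimizes the energy for conductances [c]. As its drop is 1, the
    value of the current equals the energy. *)
Lemma electric_potential (c : edge G -> R) (s t : vertex G) :
  (forall e, 0 <= c e) -> s != t ->
  exists pi : vertex G -> R,
    [/\ forall v, 0 <= pi v <= 1, pi s = 0, pi t = 1 &
        forall phi : vertex G -> R,
          \sum_e c e * (pi (head e) - pi (tail e)) * (phi (head e) - phi (tail e)) =
          (\sum_e c e * (pi (head e) - pi (tail e)) ^+ 2) * (phi t - phi s)].
Proof.
move=> c0 st.
pose m (e : edge G) v : R := (v == head e)%:R - (v == tail e)%:R.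
have sum_eq (F : vertex G -> R) w : \sum_v (v == w)%:R * F v = F w.
  rewrite (bigD1 w) //= eqxx mul1r big1 ?addr0 // => v /negbTE ->.
  by rewrite mul0r.
have mE (F : vertex G -> R) e : \sum_v m e v * F v = F (head e) - F (tail e).
  under eq_bigr => v _ do rewrite mulrBl.
  by rewrite sumrB !sum_eq.
(* The bounds pin [s] to 0 and [t] to 1 and confine other vertices to [0, 1]; the plane constraint
   is the trivial [0 = 0]. *)
have feas0 : exists u : vertex G -> R,
    (forall v, (v == t)%:R <= u v <= (v != s)%:R) /\ \sum_v 0 * u v = 0.
  exists (fun v => (v == t)%:R); split=> [v|]; last by apply: big1 => v _; rewrite mul0r.
  rewrite lexx /=; have [->|_] := eqVneq v t; last by rewrite ler0n.
  by rewrite eq_sym st.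
have [pi [pib _] vi] := variational_inequality m c (fun=> 0) feas0.
have pi01 v : 0 <= pi v <= 1.
  have /andP[lo hi] := pib v; rewrite (le_trans (ler0n _ _) lo) (le_trans hi) //.
  by case: (_ != _).
have pis : pi s = 0.
  have /andP[lo hi] := pib s; move: lo hi; rewrite eqxx (negbTE st) /=.
  by move=> lo hi; apply/eqP; rewrite eq_le lo hi.
have pit : pi t = 1.
  by have /andP[lo hi] := pib t; apply/eqP; rewrite eq_le; case/andP: (pi01 t) => _ ->;
    move: lo; rewrite eqxx.
exists pi; split=> //.
pose D (phi : vertex G -> R) :=
  \sum_e c e * (pi (head e) - pi (tail e)) * (phi (head e) - phi (tail e)).
pose ind (v w : vertex G) : R := (w == v)%:R.
have vary v k : v != s -> v != t -> 0 <= pi v + k <= 1 -> 0 <= k * D (ind v).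
  move=> vs vt pk; pose w u := pi u + k * ind v u.
  have /vi : (forall u, (u == t)%:R <= w u <= (u != s)%:R) /\ \sum_u 0 * w u = 0.
    split=> [u|]; last by apply: big1 => u _; rewrite mul0r.
    rewrite /w /ind; have [->|_] := eqVneq u v; last by rewrite mulr0 addr0.
    by rewrite vs (negbTE vt) mulr1.
  congr (0 <= _); rewrite /D mulr_sumr; apply: eq_bigr => e _.
  by rewrite !mE /w; ring.
(* Where a bound is active, only one direction of variation is allowed; the other sign holds
   termwise, since [pi v] is then extremal among all values. *)
have harmonic v : v != s -> v != t -> D (ind v) = 0.
  move=> vs vt; have /andP[lo hi] := pi01 v.
  have /(vary v _ vs vt) : 0 <= pi v + - pi v <= 1 by rewrite subrr lexx ler01.
  have /(vary v _ vs vt) : 0 <= pi v + (1 - pi v) <= 1.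
    by rewrite addrC subrK lexx ler01.
  have [pv0|pv_ne0] := eqVneq (pi v) 0.
    rewrite pv0 subr0 mul1r => D0 _; apply/eqP; rewrite eq_le D0 andbT.
    apply: sumr_le0 => e _; rewrite -mulrA; apply: mulr_ge0_le0 => //.
    have /andP[h0 _] := pi01 (head e); have /andP[t0 _] := pi01 (tail e).
    rewrite /ind; case: eqP => [->|_]; case: eqP => [->|_]; rewrite ?pv0 ?mulr1n ?mulr0n; lra.
  have [pv1|pv_ne1] := eqVneq (pi v) 1.
    rewrite pv1 => _; rewrite mulN1r oppr_ge0 => D0; apply/eqP; rewrite eq_le D0 /=.
    apply: sumr_ge0 => e _; rewrite -mulrA; apply: mulr_ge0 => //.
    have /andP[_ h0] := pi01 (head e); have /andP[_ t0] := pi01 (tail e).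
    rewrite /ind; case: eqP => [->|_]; case: eqP => [->|_]; rewrite ?pv1 ?mulr1n ?mulr0n; lra.
  have lo' : 0 < pi v by rewrite lt_neqAle eq_sym pv_ne0.
  have hi' : 0 < 1 - pi v by rewrite subr_gt0 lt_neqAle pv_ne1.
  rewrite pmulr_rge0 // mulNr oppr_ge0 pmulr_rle0 // => D1 D2.
  by apply/eqP; rewrite eq_le D1 D2.
have D0 psi : psi s = 0 -> psi t = 0 -> D psi = 0.
  move=> psis psit; have -> : D psi = \sum_v psi v * D (ind v).
    under [RHS]eq_bigr => v _ do rewrite mulr_sumr.
    rewrite exchange_big /=; apply: eq_bigr => e _.
    rewrite -(sum_eq psi (head e)) -(sum_eq psi (tail e)) -sumrB mulr_sumr.
    by apply: eq_bigr => v _; rewrite /ind ![_ == v]eq_sym; ring.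
  apply: big1 => v _; have [->|vs] := eqVneq v s; first by rewrite psis mul0r.
  have [->|vt] := eqVneq v t; first by rewrite psit mul0r.
  by rewrite harmonic ?mulr0.
(* Subtracting the right multiple of [pi] makes the test potential vanish at both terminals. *)
move=> phi; have := D0 (fun v => phi v - phi s - (phi t - phi s) * pi v).
rewrite pis pit mulr0 subrr subr0 mulr1 subrr => /(_ erefl erefl) D0phi.
apply/eqP; rewrite -subr_eq0 -[X in _ == X]D0phi; apply/eqP.
rewrite mulr_suml -sumrB; apply: eq_bigr => e _; ring.
Qed.

(** Conductance [M] inside [S1], inside [S2] and on the arcs from [y] to [x], and 1 on the rest of
    [H], forces a current above the number of edges. If the potential never fell along an edge of
    [H], the cut around [S1] could not carry it: strong arcs cross it only backwards and weak edges
    carry at most 1 each. *)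
Lemma reversed_current (H : {set edge G}) (p : vertex G -> nat) s t :
  increasing H p -> has_reversal H s t ->
  exists (c : edge G -> R) (pi : vertex G -> R) (I : R) e0,
    [/\ forall e, e \in H -> 0 < c e, forall e, e \notin H -> c e = 0,
        [/\ forall v, 0 <= pi v <= 1, pi s = 0 & pi t = 1],
        0 < I /\ (forall phi : vertex G -> R,
          \sum_e c e * (pi (head e) - pi (tail e)) * (phi (head e) - phi (tail e)) =
          I * (phi t - phi s)) &
        e0 \in H /\ pi (head e0) < pi (tail e0)].
Proof.
move=> incr [S1 [S2 [x [y [disj [sS1 xS1 yS2 tS2] yx con1 con2]]]]].
have notS2 v : v \in S1 -> v \in S2 -> False.
  by move=> vS1 vS2; move/pred0P: disj => /(_ v) /=; rewrite vS1 vS2.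
pose strong e := (e \in H) && [|| (tail e \in S1) && (head e \in S1),
  (tail e \in S2) && (head e \in S2) | (tail e == y) && (head e == x)].
pose N : R := #|vertex G|%:R; pose E : R := #|edge G|%:R.
have N0 : 0 < N by rewrite ltr0n; apply/card_gt0P; exists s.
have E0 : 0 <= E by rewrite ler0n.
(* A strong edge with potential jump at least [N^-1] alone contributes [E + 1] to the energy. *)
pose M : R := N ^+ 2 * (E + 1).
have M0 : 0 < M by rewrite mulr_gt0 ?exprn_gt0 //; lra.
pose c e : R := if e \in H then (if strong e then M else 1) else 0.
have cH e : e \in H -> 0 < c e by rewrite /c => ->; case: ifP.
have c0 e : 0 <= c e.
  by have [/cH/ltW //|nH] := boolP (e \in H); rewrite /c (negbTE nH).
have st : s != t by apply/eqP => st; apply: (notS2 s) => //; rewrite st.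
have [pi [pi01 pis pit curr]] := electric_potential c0 st.
set I := \sum_e _ in curr.
pose link u v := [exists e, strong e &&
  (((tail e == u) && (head e == v)) || ((tail e == v) && (head e == u)))].
have link_in S u v : (S == S1) || (S == S2) -> adj_in H S u v -> link u v.
  move=> SE /and3P[uS vS /orP[]/arcP[e [eH te he]]]; apply/existsP; exists e;
  rewrite /strong eH te he !eqxx ?orbT ?andbT /=;
  by case/orP: SE => /eqP <-; rewrite uS vS ?orbT.
have sub S u v : (S == S1) || (S == S2) -> connect (adj_in H S) u v -> connect link u v.
  move=> SE; apply: connect_sub => {}u {}v uv; apply: connect1.
  exact: link_in uv.
have link_st : connect link s t.
  apply: connect_trans (sub S1 _ _ _ con1) _; first by rewrite eqxx.
  apply: connect_trans (sub S2 _ _ _ con2); last by rewrite eqxx orbT.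
  apply: connect1; case/arcP: yx => e [eH te he]; apply/existsP; exists e.
  by rewrite /strong eH te he !eqxx !orbT.
(* A simple strong path from [s] to [t] has fewer than [N] steps and a total rise of 1. *)
have [e1 st1 big_jump] : exists2 e, strong e & N^-1 <= `|pi (head e) - pi (tail e)|.
  apply: contrapT => none.
  have small u v : link u v -> pi v - pi u <= N^-1.
    move=> /existsP[e /andP[se uv]]; rewrite leNgt; apply/negP=> lt.
    apply: none; exists e => //; apply: le_trans (ltW lt) _.
    case/orP: uv => /andP[/eqP-> /eqP->]; first exact: ler_norm.
    by rewrite distrC; exact: ler_norm.
  case/connectP: link_st => q /shortenP[q' pathq uq _] tE.
  have : pi t - pi s <= (size q')%:R * N^-1.
    rewrite tE; elim: q' (s) pathq {uq tE} => [|v q' IHq] u /=.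
      by rewrite subrr mul0r.
    case/andP=> /small uv /IHq; rewrite -natr1 mulrDl mul1r; lra.
  rewrite pis pit subr0 ler_pdivlMr // mul1r ler_nat leqNgt.
  by have /card_uniqP := uq; rewrite /= => <-; rewrite max_card.
have I_large : E + 1 <= I.
  have term0 e : 0 <= c e * (pi (head e) - pi (tail e)) ^+ 2.
    by rewrite mulr_ge0 ?sqr_ge0.
  apply: (@le_trans _ _ (c e1 * (pi (head e1) - pi (tail e1)) ^+ 2)); last first.
    by rewrite /I (bigD1 e1) //= lerDl sumr_ge0.
  have -> : c e1 = M by rewrite /c st1; case/andP: st1 => ->.
  rewrite -(real_normK (num_real _)) /M mulrAC -exprMn.
  apply: ler_peMl; first lra.
  by apply: exprn_ege1; rewrite mulrC -ler_pdivrMr // mul1r.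
exists c, pi, I.
have [e0 [e0H lt0]] : exists e0, e0 \in H /\ pi (head e0) < pi (tail e0); last first.
  exists e0; split=> //; first by move=> e /negbTE nH; rewrite /c nH.
  by split=> //; lra.
apply: contrapT => none.
have ge e : e \in H -> 0 <= pi (head e) - pi (tail e).
  move=> eH; rewrite subr_ge0 leNgt; apply/negP => lt; apply: none.
  by exists e.
pose phi v : R := (v \notin S1)%:R.
have := curr phi; rewrite /phi sS1 /=.
have -> /= : t \notin S1 by apply/negP => tS1; exact: notS2 tS1 tS2.
rewrite subr0 mulr1 => IE; suff : I <= E by lra.
rewrite -IE.
apply: (@le_trans _ _ (\sum_(e : edge G) 1)); last by rewrite sumr_const.
apply: ler_sum => e _; rewrite /c; case: ifP => [eH|_]; last by rewrite !mul0r ler01.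
have /andP[h0 h1] := pi01 (head e); have /andP[t0 t1] := pi01 (tail e).
have ge_e := ge _ eH.
case: ifP => [/andP[_ /or3P[/andP[-> ->]|/andP[tS hS]|/andP[/eqP tE /eqP hE]]]|_].
- by rewrite subrr mulr0 ler01.
- have -> : tail e \notin S1 by apply/negP => vS1; exact: notS2 vS1 tS.
  have -> : head e \notin S1 by apply/negP => vS1; exact: notS2 vS1 hS.
  by rewrite subrr mulr0 ler01.
- have -> : tail e \notin S1 by apply/negP; rewrite tE => vS1; exact: notS2 vS1 yS2.
  rewrite hE xS1 /= sub0r mulrN1; apply: (@le_trans _ _ 0) => //.
  by rewrite oppr_le0 -hE mulr_ge0 // ltW.
- by case: (head e \notin S1); case: (tail e \notin S1); rewrite ?mulr1n ?mulr0n; lra.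
Qed.

End Electric.

(** * A reversal makes the equilibrium cost non-concave *)

Section Reversal.
Variables (R : realType) (G : network).

Lemma sum_count_walk (w : seq (edge G)) (F : edge G -> R) :
  \sum_e (count_mem e w)%:R * F e = \sum_(e <- w) F e.
Proof.
elim: w => [|e0 w IHw]; first by rewrite big_nil big1 // => e _; rewrite mul0r.
rewrite big_cons -IHw (bigD1 e0) //= [in RHS](bigD1 e0) //= eqxx natrD mulrDl mul1r.
rewrite -addrA; congr (_ + (_ + _)); apply: eq_bigr => e /negbTE ne.
by rewrite eq_sym ne.
Qed.

(** One walk from source to sink is taken through each edge of [H], and edges are counted with
    multiplicity. *)
Lemma spanning_flow (H : {set edge G}) :
  spanned H (source G) (sink G) ->
  exists f : edge G -> R,
    [/\ is_flow f #|H|%:R, forall e, e \in H -> 0 < f e &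
        forall e, e \notin H -> f e = 0].
Proof.
move=> span.
have /choice[w wP] : forall e, exists p, e \in H ->
    [/\ walk (source G) (sink G) p, {subset p <= H} & e \in p].
  move=> e; have [eH|_] := boolP (e \in H); last by exists [::].
  have [/connect_walk[p1 w1 s1] /connect_walk[p2 w2 s2]] := span e eH.
  exists (p1 ++ e :: p2) => _; split.
  - by rewrite walk_split w1.
  - by move=> e'; rewrite mem_cat inE => /or3P[/s1|/eqP->|/s2].
  - by rewrite mem_cat inE eqxx orbT.
exists (fun e => \sum_(k in H) (count_mem e (w k))%:R); split=> [phi|e eH|e nH].
- under eq_bigr => e _ do rewrite mulr_suml.
  rewrite exchange_big /=.
  under eq_bigr => k kH.
    rewrite sum_count_walk; have [wk _ _] := wP k kH.
    rewrite (walk_telescope phi wk); over.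
  by rewrite sumr_const mulr_natl.
- rewrite (bigD1 e) //= ltr_wpDr ?sumr_ge0 // ltr0n -has_count has_pred1.
  by have [_ _] := wP e eH.
- apply: big1 => k kH; rewrite (count_memPn _) //; apply: contra nH.
  by have [_ sk _] := wP k kH; exact: sk.
Qed.

(* All edges of [H] are used at the demands [r0 < r1]; raising the demand adds a
   multiple of an electric current, and at [r1] this drives the flow on the
   reversed edge to zero.  Beyond [r1] the current is no longer available, and by
   the minimality of its energy the equilibrium cost rises faster than before. *)
Lemma reversal_not_optimal (H : {set edge G}) (p : vertex G -> nat) :
  (forall v : vertex G, exists q, walk (source G) v q) ->
  increasing H p -> spanned H (source G) (sink G) ->
  has_reversal H (source G) (sink G) ->
  ~ full_information_always_optimal R G.
Proof.
move=> reach incr span rev opt.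
have [c [pi [I [e0 [cH cN [pi01 pis pit] [I0 curr] [e0H lt0]]]]]] :=
  reversed_current R incr rev.
have [fB [flB fB0 fBN]] := spanning_flow span.
pose dpi e := pi (head e) - pi (tail e).
pose g e := c e * dpi e.
have flg : is_flow g I by exact: curr.
have g0 : g e0 < 0 by rewrite /g pmulr_rlt0 ?cH // subr_lt0.
have gN e : e \notin H -> g e = 0 by move=> nH; rewrite /g cN // mul0r.
pose back e := (e \in H) && (g e < 0).
have back0 : back e0 by rewrite /back e0H g0.
(* Ratio test: [e1] is the first edge emptied when multiples of the current are added, and [eta] is
   the multiple at which this happens. *)
have [e1 /andP[e1H g1] e1_min] :=
  @Order.TotalTheory.arg_minP _ R _ e0 back (fun e => fB e / - g e) back0.
pose eta := fB e1 / - g e1.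
have eta0 : 0 < eta by apply: divr_gt0; [exact: fB0 | rewrite oppr_gt0].
pose beta : R := #|H|%:R.
have beta0 : 0 < beta by rewrite ltr0n; apply/card_gt0P; exists e0.
(* Scaling by [L = T^-1] makes the demand 1 after twice the critical multiple. Thus [e1] runs empty
   exactly at the midpoint of [r0] and 1. *)
pose T := beta + 2 * eta * I.
have etaI : 0 < eta * I by exact: mulr_gt0.
have T0 : 0 < T by rewrite /T -mulrA; lra.
pose L := T^-1; pose zeta := L * eta; pose r0 := L * beta.
have L0 : 0 < L by rewrite invr_gt0.
have zeta0 : 0 < zeta by exact: mulr_gt0.
have zetaI : 0 < zeta * I by exact: mulr_gt0.
have r0_gt0 : 0 < r0 by exact: mulr_gt0.
have sum1 : r0 + 2 * (zeta * I) = 1.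
  have -> : r0 + 2 * (zeta * I) = L * T by rewrite /r0 /zeta /T; ring.
  by rewrite mulVf // gt_eqF.
pose f0 e := L * fB e; pose f1 e := f0 e + zeta * g e.
have fl0 : is_flow f0 r0 by exact: is_flow_scale.
have fl1 : is_flow f1 (r0 + zeta * I).
  move=> phi; rewrite mulrDl -fl0 -(is_flow_scale zeta flg) -big_split /=.
  by apply: eq_bigr => e _; rewrite -mulrDl.
have f0N e : e \notin H -> f0 e = 0 by move=> nH; rewrite /f0 fBN ?mulr0.
have f0_gt0 e : e \in H -> 0 < f0 e by move=> eH; apply: mulr_gt0 => //; exact: fB0.
have f0_ge0 e : 0 <= f0 e.
  by have [/f0_gt0/ltW //|/f0N ->] := boolP (e \in H).
have f1N e : e \notin H -> f1 e = 0 by move=> nH; rewrite /f1 f0N ?gN ?mulr0 ?addr0.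
have f1E e : f1 e = L * (fB e + eta * g e) by rewrite /f1 /f0 /zeta; ring.
have f1_ge0 e : 0 <= f1 e.
  have [eH|/f1N -> //] := boolP (e \in H).
  rewrite f1E pmulr_rge0 //; have [ge0|lt] := leP 0 (g e).
    by apply: addr_ge0; [exact/ltW/fB0 | apply: mulr_ge0 => //; exact: ltW].
  have := e1_min e; rewrite /back eH lt -/eta => /(_ isT).
  by rewrite ler_pdivlMr ?oppr_gt0 //; lra.
have f1e1 : f1 e1 = 0.
  by rewrite f1E /eta; field; rewrite lt_eqF.
(* Slopes are resistances. By Ohm's law, adding [zeta * g] to the flow raises each edge cost on [H]
   by [zeta * dpi e]. *)
pose a e : R := if e \in H then (c e)^-1 else 1.
have a0 e : 0 < a e by rewrite /a; case: ifP => // eH; rewrite invr_gt0 cH.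
have ag e : e \in H -> a e * g e = dpi e.
  by move=> eH; rewrite /a eH /g mulrA mulVf ?mul1r // gt_eqF // cH.
pose K := \sum_e a e * f0 e.
have af0 e : 0 <= a e * f0 e by rewrite mulr_ge0 // ltW.
have K_ge e : a e * f0 e <= K by rewrite /K (bigD1 e) //= lerDl sumr_ge0.
have K0 : 0 <= K by exact: sumr_ge0.
pose dp e : R := (p (head e))%:R - (p (tail e))%:R.
(* On [H], [b] makes the potential [K * p] tight for [f0]; it is nonnegative since ranks rise by at
   least 1 and [K] dominates every [a e * f0 e]. Off [H], one [zeta] covers the rise from [P0] to
   [P1] and the other two the term [2 * zeta * dpi e] in [edge_le]. *)
pose b e : R := if e \in H then K * dp e - a e * f0 e else K * `|dp e| + 3 * zeta.
have bH e : e \in H -> b e = K * dp e - a e * f0 e by rewrite /b => ->.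
have bN e : e \notin H -> b e = K * `|dp e| + 3 * zeta by rewrite /b => /negbTE ->.
have dpH e : e \in H -> 1 <= dp e.
  by move=> /incr lt; rewrite /dp lerBrDr nat1r ler_nat.
have b0 e : 0 <= b e.
  have [eH|nH] := boolP (e \in H); last first.
    by rewrite bN //; have := mulr_ge0 K0 (normr_ge0 (dp e)); lra.
  rewrite bH // subr_ge0; apply: le_trans (K_ge e) _.
  by rewrite ler_peMr // dpH.
have dpi_le1 e : dpi e <= 1.
  have /andP[h0 h1] := pi01 (head e); have /andP[t0 t1] := pi01 (tail e).
  by rewrite /dpi; lra.
pose P0 v := K * (p v)%:R; pose P1 v := P0 v + zeta * pi v.
have dP0 e : P0 (head e) - P0 (tail e) = K * dp e by rewrite /P0 /dp; ring.
have dP1 e : P1 (head e) - P1 (tail e) = K * dp e + zeta * dpi e.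
  by rewrite /P1 /P0 /dp /dpi; ring.
have Kdp_le e : K * dp e <= K * `|dp e| by rewrite ler_wpM2l // ler_norm.
have zdpi_le e : zeta * dpi e <= zeta by rewrite ler_piMr // ltW.
have tight1 e : e \in H -> P1 (head e) - P1 (tail e) = a e * f1 e + b e.
  move=> eH; rewrite dP1 bH // /f1 -(ag _ eH).
  by ring.
have eq0 : is_edge_equilibrium a b r0 f0 P0.
  split=> // e; last first.
    have [eH _|/f0N ->] := boolP (e \in H); last by rewrite ltxx.
    by rewrite dP0 bH //; ring.
  rewrite dP0; have [eH|nH] := boolP (e \in H); first by rewrite bH //; lra.
  by rewrite f0N // bN // mulr0 add0r; have := Kdp_le e; lra.
have eq1 : is_edge_equilibrium a b (r0 + zeta * I) f1 P1.
  split=> // e; last first.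
    have [eH _|/f1N ->] := boolP (e \in H); last by rewrite ltxx.
    exact: tight1.
  have [eH|nH] := boolP (e \in H); first by rewrite tight1.
  by rewrite dP1 f1N // bN // mulr0 add0r; have := Kdp_le e; have := zdpi_le e; lra.
have [f2 [P2 [eq2 _]]] : exists f2 P2, is_edge_equilibrium a b 1 f2 P2 /\ True.
  have one : is_distribution (fun _ : 'I_1 => 1 : R).
    by split=> [i|]; rewrite ?big_ord1 ?ler01.
  have [f2 [P2 [eq2 _]]] := @eq_costE R G a b 'I_1 (fun=> 1) (fun=> 1) a0 b0
    (fun=> ltr01) one reach.
  exists f2, P2; move: eq2; rewrite /mean_demand /mean_square_demand !big_ord1.
  by rewrite expr1n !mulr1 divr1.
have r0_lt1 : r0 < 1 by lra.
have r1E : r0 + zeta * I = (r0 + 1) / 2 by lra.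
have mid := full_information_midpoint opt reach a0 b0 r0_gt0 r0_lt1 eq0 _ eq2.
have {mid} := mid f1 P1; rewrite -r1E => /(_ eq1) mid.
have cost1 : P1 (sink G) - P1 (source G) =
    P0 (sink G) - P0 (source G) + zeta by rewrite /P1 pis pit; ring.
have [f2_ge0 fl2 le2 tight2] := eq2.
pose h e := f2 e - f1 e.
have flh phi : \sum_e h e * (phi (head e) - phi (tail e)) =
    zeta * I * (phi (sink G) - phi (source G)).
  under eq_bigr => e _ do rewrite mulrBl.
  by rewrite sumrB fl2 fl1 -mulrBl; congr (_ * _); lra.
pose d2 e := P2 (head e) - P2 (tail e); pose d1 e := P1 (head e) - P1 (tail e).
(* On [H] this expands the square with Ohm's law and the tightness of [f1]. Off [H] both [f1] and
   [g] vanish and the margin in [b] is used. *)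
have edge_le e : a e * (h e - zeta * g e) ^+ 2 <=
    h e * d2 e - h e * d1 e - 2 * zeta * (h e * dpi e) + zeta ^+ 2 * (g e * dpi e).
  have c2h : (a e * f2 e + b e) * h e <= d2 e * h e.
    have := f2_ge0 e; rewrite le_eqVlt => /predU1P[f2e|/tight2 <- //].
    by apply: ler_wnM2r (le2 e); rewrite /h -f2e sub0r oppr_le0.
  have [eH|nH] := boolP (e \in H).
    have -> : a e * (h e - zeta * g e) ^+ 2 = a e * h e ^+ 2
        - 2 * zeta * (h e * (a e * g e)) + zeta ^+ 2 * (g e * (a e * g e)) by ring.
    rewrite ag // lerD2r lerD2r.
    have -> : a e * h e ^+ 2 = (a e * f2 e + b e) * h e - h e * d1 e.
      by rewrite /d1 tight1 // /h; ring.
    by rewrite lerD2r [leRHS]mulrC.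
  have hE : h e = f2 e by rewrite /h f1N ?subr0.
  have h0 : 0 <= h e by rewrite hE.
  rewrite gN // mulr0 subr0 mul0r mulr0 addr0.
  have slack : 0 <= (b e - d1 e - 2 * zeta * dpi e) * h e.
    apply: mulr_ge0 => //; rewrite bN // /d1 dP1.
    by have := Kdp_le e; have := zdpi_le e; lra.
  have : a e * h e ^+ 2 = (a e * f2 e + b e) * h e - b e * h e by rewrite hE; ring.
  lra.
(* Summed up, the bound is [zeta * I] times the cost rise in the second half, minus [zeta ^+ 2 * I].
   Midpoint concavity bounds that rise by [zeta], the rise in the first half. *)
have : \sum_e a e * (h e - zeta * g e) ^+ 2 <= 0.
  apply: (le_trans (ler_sum _ (fun e _ => edge_le e))).
  rewrite big_split /= !sumrB -!mulr_sumr /d2 /d1 /dpi !flh flg pis pit subr0 !mulr1.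
  set l2 := P2 _ - _ in mid *; rewrite cost1 in mid *.
  have : zeta * I * (l2 - (P0 (sink G) - P0 (source G) + zeta)) <= zeta * I * zeta.
    by rewrite ler_pM2l //; lra.
  have -> : zeta ^+ 2 * I = zeta * I * zeta by ring.
  have -> : 2 * zeta * (zeta * I) = 2 * (zeta * I * zeta) by ring.
  lra.
(* At the emptied edge the flow can only grow, whereas the current would lower it. *)
have gt0 : 0 < a e1 * (h e1 - zeta * g e1) ^+ 2.
  rewrite mulr_gt0 // exprn_even_gt0 //= gt_eqF // /h f1e1 subr0 subr_gt0.
  by apply: lt_le_trans (f2_ge0 e1); rewrite pmulr_rlt0.
rewrite (bigD1 e1) //=; have : 0 <= \sum_(i | i != e1) a i * (h i - zeta * g i) ^+ 2.
  by apply: sumr_ge0 => e _; rewrite mulr_ge0 ?sqr_ge0 // ltW.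
lra.
Qed.

End Reversal.

(** * Decomposition of networks without reversals *)

Section Acyclicity.
Variable G : network.
Implicit Types (H : {set edge G}) (S : {set vertex G}) (u v w z : vertex G).
Implicit Types (r : seq (edge G)) (q : seq (vertex G)).

Lemma adj_sym H : symmetric (adj H).
Proof. by move=> u v; rewrite /adj orbC. Qed.

Lemma arc_sub H H' u v : H \subset H' -> arc H u v -> arc H' u v.
Proof.
by move=> /fintype.subsetP sub /arcP[e [/sub eH te he]]; apply/arcP; exists e.
Qed.

Lemma connect_arc_sub H H' u v :
  H \subset H' -> connect (arc H) u v -> connect (arc H') u v.
Proof.
move=> sub; apply: connect_sub => {}u {}v uv; apply: connect1.
exact: arc_sub sub uv.
Qed.

Lemma connect_adj_in_path H S u q :
  path (adj H) u q -> {subset u :: q <= S} ->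
  connect (adj_in H S) u (last u q).
Proof.
elim: q u => [|v q IHq] u //= /andP[uv pq] sub.
have uS : u \in S by apply: sub; rewrite mem_head.
have vS : v \in S by apply: sub; rewrite !inE eqxx orbT.
apply: connect_trans (connect1 _) (IHq v pq _); first by rewrite /adj_in uS vS.
by move=> w wq; apply: sub; rewrite inE wq orbT.
Qed.

Lemma reversal_of_path H u q1 y q2 :
  path (adj H) u (q1 ++ y :: q2) -> uniq (u :: q1 ++ y :: q2) ->
  arc H y (last u q1) -> has_reversal H u (last y q2).
Proof.
rewrite cat_path => /andP[path1 /andP[_ path2]].
rewrite -cat_cons cat_uniq => /and3P[_ /hasPn disj _] yx.
exists [set v in u :: q1], [set v in y :: q2], (last u q1), y; split=> //.
- apply/pred0P => v /=; rewrite [v \in [set _ in u :: _]]inE.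
  rewrite [v \in [set _ in y :: _]]inE.
  by apply/negP => /andP[v1 /disj]; rewrite v1.
- have inP (s : seq (vertex G)) v : (v \in [set w in s]) = (v \in s) by rewrite inE.
  by rewrite !inP !mem_head !mem_last.
- by apply: connect_adj_in_path => // v vq; rewrite inE.
- by apply: connect_adj_in_path => // v vq; rewrite inE.
Qed.

Lemma path_exits (T : eqType) (e : rel T) (X : pred T) x (q : seq T) :
  path e x q -> x \in X -> last x q \notin X ->
  exists (q1 : seq T) (y : T) (q2 : seq T),
    [/\ q = q1 ++ y :: q2, last x q1 \in X, y \notin X &
        e (last x q1) y].
Proof.
elim: q x => [|y q IHq] x /=; first by move=> _ ->.
case/andP=> xy pq xX lastX; have [yX|yX] := boolP (y \in X).
  have [q1 [y' [q2 [-> ? ? ?]]]] := IHq y pq yX lastX.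
  by exists (y :: q1), y', q2.
by exists [::], y, q.
Qed.

Lemma walk_vertices u v r :
  walk u v r -> vertices_from u r = rcons [seq tail e | e <- r] v.
Proof.
rewrite /vertices_from; elim: r u => [|e r IHr] u /=; first by move/eqP->.
by case/andP=> /eqP -> /IHr <-.
Qed.

Lemma walk_connect H u v r :
  walk u v r -> {subset r <= H} -> connect (arc H) u v.
Proof.
elim: r u => [|e r IHr] u /=; first by move=> /eqP -> _; exact: connect0.
case/andP=> /eqP <- wr sub; apply: connect_trans (connect1 (arc_edge _)) (IHr _ wr _).
  by apply: sub; rewrite mem_head.
by move=> k kr; apply: sub; rewrite inE kr orbT.
Qed.

(* New ranks: the inner vertices of the ear come after all old ranks, and the
   vertices reachable from its end [w] after these. *)
Lemma add_ear H (p : vertex G -> nat) z w r :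
  increasing H p -> walk z w r -> uniq (vertices_from z r) ->
  (forall e, e \in H -> tail e \notin behead [seq tail k | k <- r] /\
                        head e \notin behead [seq tail k | k <- r]) ->
  ~~ connect (arc H) w z ->
  exists p', increasing (H :|: [set e in r]) p'.
Proof.
move=> incr wr uniq_r fresh nwz.
have verts := walk_vertices wr; rewrite verts rcons_uniq in uniq_r.
have /andP[w_notin uniq_t] := uniq_r.
pose K0 := \max_v p v; have p_le v : (p v <= K0)%N by exact: leq_bigmax.
pose inner := behead [seq tail k | k <- r].
(* Inner vertices have indices from 1 to [size r - 1], so their ranks lie above [K0] and below the
   shift [K0 + size r + 2]. *)
pose p' x := if x \in inner then (K0 + 1 + index x [seq tail k | k <- r])%N
  else if connect (arc H) w x then (p x + (K0 + size r + 2))%N else p x.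
exists p' => e; rewrite !inE => /orP[eH|er].
  have [/negbTE te /negbTE he] := fresh e eH.
  rewrite /p' te he; have lt := incr e eH.
  have [wt|_] := boolP (connect (arc H) w (tail e)).
    by rewrite (connect_trans wt (connect1 (arc_edge eH))) ltn_add2r.
  by case: ifP => // _; apply: leq_trans lt _; rewrite leq_addr.
have [r1 [r2 rE]] : exists r1 r2, r = r1 ++ e :: r2.
  by case/splitPr: er => r1 r2; exists r1, r2.
have idx_tail : index (tail e) [seq tail k | k <- r] = size r1.
  move: uniq_t; rewrite rE map_cat /= cat_uniq => /and3P[_ /hasPn h _].
  rewrite index_cat /= eqxx addn0 size_map ifN //.
  by apply: h; rewrite mem_head.
have p'tail : (p' (tail e) < K0 + 1 + (size r1).+1)%N.
  rewrite /p' idx_tail; case: ifP => [_|notin]; first by rewrite ltn_add2l.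
  have r10 : r1 = [::].
    case: r1 rE {idx_tail} => // k r1 rE; move: notin; rewrite /inner rE /= map_cat mem_cat.
    by rewrite /= mem_head orbT.
  have tz : tail e = z by move: wr; rewrite rE r10 /= => /andP[/eqP].
  by rewrite tz (negbTE nwz); have := p_le z; lia.
apply: (leq_trans p'tail); move: wr; rewrite rE walk_split => /andP[w1].
case: r2 rE => [|k r2] rE /=.
  move/eqP=> he; rewrite he /p' ifN; last first.
    by apply: contra w_notin => /mem_behead.
  rewrite connect0 rE size_cat /=; lia.
case/andP=> /eqP tk _; rewrite -tk.
have idx_head : index (tail k) [seq tail i | i <- r] = (size r1).+1.
  move: uniq_t; rewrite rE -cat_rcons map_cat /= cat_uniq => /and3P[_ /hasPn h _].
  rewrite index_cat /= eqxx addn0 size_map size_rcons ifN //.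
  by apply: h; rewrite mem_head.
rewrite /p' idx_head ifT ?leqnn // /inner rE.
by case: r1 {rE w1 p'tail idx_tail idx_head} => [|k' r1];
  rewrite /= ?map_cat ?mem_cat /= ?inE eqxx ?orbT.
Qed.

Variables s t : vertex G.

(** The empty set meets the first two clauses; the third excludes it when [s] and [t] differ and
    puts both on a route. *)
Definition good H : Prop :=
  [/\ exists p, increasing H p, spanned H s t & connect (arc H) s t].

Definition on_route H v := connect (arc H) s v && connect (arc H) v t.

Lemma spanned_on_route H e :
  spanned H s t -> e \in H -> on_route H (tail e) /\ on_route H (head e).
Proof.
move=> span eH; have [st_ te] := span e eH; have eA := connect1 (arc_edge eH).
by split; apply/andP; split=> //; [exact: connect_trans te | exact: connect_trans eA].
Qed.

Lemma spanned_add_ear H z w r :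
  spanned H s t -> connect (arc H) s z -> connect (arc H) w t -> walk z w r ->
  spanned (H :|: [set e in r]) s t.
Proof.
move=> span sz wt wr e; rewrite !inE => /orP[/span[se et]|er].
  by split; [apply: connect_arc_sub se | apply: connect_arc_sub et]; exact: finset.subsetUl.
have [r1 [r2 rE]] : exists r1 r2, r = r1 ++ e :: r2.
  by case/splitPr: er => r1 r2; exists r1, r2.
move: wr; rewrite rE walk_split => /andP[w1 w2]; split.
  apply: connect_trans (connect_arc_sub (finset.subsetUl _ _) sz) _.
  by apply: (walk_connect w1) => k kr; rewrite !inE mem_cat kr orbT.
apply: connect_trans (connect_arc_sub (finset.subsetUl _ _) wt).
by apply: (walk_connect w2) => k kr; rewrite !inE mem_cat inE kr !orbT.
Qed.

Definition mixed_step H (Q : seq (edge G)) : rel (vertex G) :=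
  fun u v => [exists e in H, [&& e \in Q, tail e == u & head e == v]] || arc H v u.

(** [Q] is followed from [s] to [t]. An edge of [H] is a forward step. Any other stretch between
    vertices on routes is an ear; by maximality adding it closes a cycle, so [H] contains a path
    back that can be traversed in reverse. *)
Lemma maximal_good_mixed H Q :
  good H -> (forall H', good H' -> H \subset H' -> H' = H) ->
  walk s t Q -> uniq (vertices_from s Q) ->
  connect (mixed_step H Q) s t.
Proof.
move=> [[p incr] span st] max.
have Cs : on_route H s by rewrite /on_route connect0.
have Ct : on_route H t by rewrite /on_route connect0 andbT.
have rev u v : connect (arc H) v u -> connect (mixed_step H Q) u v.
  rewrite connect_rev => vu; apply: connect_sub vu => {}u {}v uv.
  by apply: connect1; rewrite /mixed_step /=; apply/orP; right.
(* Here [z] is the last vertex reached on a route, [pre] the pending stretch of [Q] from [z] to [c],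
   and [r] the rest of [Q]. *)
suff main r z pre c : connect (mixed_step H Q) s z -> on_route H z ->
    walk z c pre -> walk c t r -> uniq (vertices_from z (pre ++ r)) ->
    {subset pre ++ r <= Q} ->
    all (predC (on_route H)) (behead (rcons [seq tail k | k <- pre] c)) ->
    connect (mixed_step H Q) s t.
  by move=> wQ uQ; apply: (main Q s [::] s); rewrite //= eqxx.
elim: r z pre c => [|e r IHr] z pre c sz Cz wpre.
  move=> /eqP cE _ _ fresh; case: pre wpre fresh => [|k pre] /=.
    by move=> /eqP zc _; rewrite -cE -zc.
  by rewrite cE all_rcons /= Ct.
rewrite [walk c t _]/= => /andP[/eqP tc wr] uq sub fresh.
have ear : walk z (head e) (rcons pre e) by rewrite -cats1 walk_split tc wpre /=.
have uear : uniq (vertices_from z (rcons pre e)).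
  by move: uq; rewrite -cat_rcons /vertices_from map_cat -cat_cons cat_uniq => /andP[].
have [Cw|nCw] := boolP (on_route H (head e)); last first.
  apply: (IHr z (rcons pre e) (head e)) => //; rewrite ?cat_rcons //.
  rewrite map_rcons tc; case: (pre) fresh => [|k pre'] /= fr; first by rewrite nCw.
  by rewrite all_rcons /= nCw.
apply: (IHr (head e) [::] (head e)) => //=.
- apply: connect_trans sz _; have [eH|eN] := boolP (e \in H).
    have Cc : on_route H c by rewrite -tc; have [] := spanned_on_route span eH.
    case: pre wpre fresh sub {uq ear uear} => [|k pre] /=; last first.
      by rewrite all_rcons /= Cc.
    move=> /eqP -> _ sub; apply: connect1; apply/orP; left; apply/existsP; exists e.
    by rewrite eH tc !eqxx sub ?mem_head.
  have [wz|nwz] := boolP (connect (arc H) (head e) z); first exact: rev.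
  have inner : behead [seq tail k | k <- rcons pre e] =
      behead (rcons [seq tail k | k <- pre] c) by rewrite map_rcons tc.
  have [] : ~ good (H :|: [set k in rcons pre e]).
    move=> gH'; have := max _ gH' (finset.subsetUl _ _) => /setP/(_ e).
    by rewrite !inE mem_rcons mem_head orbT (negbTE eN).
  have /andP[sz' _] := Cz; have /andP[_ wt] := Cw.
  split.
  - apply: add_ear incr ear uear _ nwz => k kH; rewrite inner.
    have [Ctk Chk] := spanned_on_route span kH; move/allP: fresh => fresh.
    by split; apply/negP => /fresh /=; rewrite ?Ctk ?Chk.
  - exact: spanned_add_ear sz' wt ear.
  - exact: connect_arc_sub (finset.subsetUl _ _) st.
- by move: uq; rewrite -cat_rcons /vertices_from map_cat map_rcons cat_rcons -cat_cons
    cat_uniq => /and3P[].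
- by move=> k kr; apply: sub; rewrite mem_cat inE kr !orbT.
Qed.

(** If [e] on [Q] were missing from [H], the mixed path would have to leave the vertices of [Q] up
    to the tail of [e]. Edges of [Q] other than [e] do not leave this set, so the exit runs against
    an arc of [H]. *)
Lemma maximal_good_full H :
  (forall e, exists Q, [/\ walk s t Q, uniq (vertices_from s Q) & e \in Q]) ->
  good H -> ~ has_reversal H s t ->
  (forall H', good H' -> H \subset H' -> H' = H) -> H = [set: edge G].
Proof.
move=> cover gH norev max; apply/setP => e; rewrite inE; apply/negPn/negP => eN.
have [Q [wQ uQ eQ]] := cover e.
have /connectP[q0 /shortenP[q path_q uniq_q _] tE] := maximal_good_mixed gH max wQ uQ.
have [Q1 [Q2 QE]] : exists Q1 Q2, Q = Q1 ++ e :: Q2.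
  by case/splitPr: eQ => Q1 Q2; exists Q1, Q2.
have verts := walk_vertices wQ.
have w1 : walk s (tail e) Q1 by move: wQ; rewrite QE walk_split => /andP[].
have XE := walk_vertices w1.
pose X := mem (vertices_from s Q1).
have memX v : (v \in X) = (v \in rcons [seq tail k | k <- Q1] (tail e)) by rewrite -XE.
have sX : s \in X by exact: mem_head.
have uniq_tails : uniq (rcons [seq tail k | k <- Q] t) by rewrite -verts.
have tX : t \notin X.
  rewrite memX; apply/negP => tin; move: uniq_tails.
  rewrite rcons_uniq QE map_cat /= mem_cat inE => /andP[/negP notin _].
  by apply: notin; move: tin; rewrite mem_rcons in_cons => /orP[] h; rewrite h /= ?orbT.
rewrite tE in tX.
have [q1 [y [q2 [qE q1X yX step]]]] := path_exits path_q sX tX.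
have adj_step u v : mixed_step H Q u v -> adj H u v.
  case/orP=> [/exists_inP[k kH /and3P[_ tk hk]]|vu]; last by rewrite /adj vu orbT.
  by apply/orP; left; apply/exists_inP; exists k => //; rewrite tk.
apply: norev; rewrite tE qE last_cat /=.
apply: (@reversal_of_path H s q1 y q2).
- by rewrite -qE; apply: sub_path path_q => u v; exact: adj_step.
- by rewrite -qE.
case/orP: step => // /exists_inP[k kH /and3P[kQ /eqP tk /eqP hk]].
case/negP: yX; rewrite -hk.
have kQ1 : k \in Q1.
  have : k \in Q1 ++ e :: Q2 by rewrite -QE.
  rewrite mem_cat inE => /or3P[//|/eqP ke|k2]; first by rewrite -ke kH in eN.
  move: q1X; rewrite -tk memX mem_rcons inE => in1.
  move: uniq_tails; rewrite rcons_uniq QE map_cat /= => /andP[_].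
  rewrite cat_uniq /= => /and4P[_ /norP[_ /hasPn no] notin _].
  case/orP: in1 => [/eqP tke|in1].
    by case/negP: notin; rewrite -tke map_f.
  by have := no (tail k) (map_f _ k2); rewrite in1.
by apply: mem_behead; exact: map_f.
Qed.

Lemma increasing_of_no_reversal :
  (forall e, exists Q, [/\ walk s t Q, uniq (vertices_from s Q) & e \in Q]) ->
  (exists2 Q, walk s t Q & uniq (vertices_from s Q)) -> s != t ->
  (forall H, good H -> ~ has_reversal H s t) -> good [set: edge G].
Proof.
move=> cover [Q wQ uQ] st norev.
(* The ears start from a single path, itself an ear on the empty set. *)
have good0 : good [set e in Q].
  have nts : ~~ connect (arc finset.set0) t s.
    apply/negP => /connectP[[|v q] /=]; first by move=> _ tE; rewrite tE eqxx in st.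
    by case/andP=> /arcP[e []]; rewrite inE.
  have incr0 : increasing finset.set0 (fun _ : vertex G => 0%N) by move=> e; rewrite inE.
  have span0 : spanned finset.set0 s t by move=> e; rewrite inE.
  have [|p incr] := add_ear incr0 wQ uQ _ nts; first by move=> e; rewrite inE.
  have := spanned_add_ear span0 (connect0 _ _) (connect0 _ _) wQ.
  rewrite finset.set0U in incr *; move=> span; split=> //; first by exists p.
  by apply: (walk_connect wQ) => e eQ; rewrite inE.
have [H [gH max]] : exists H, good H /\ forall H', good H' -> H \subset H' -> H' = H.
  have [|H /maxsetP[/asboolP gH max]] :=
    @ex_maxset _ (fun H : {set edge G} => `[< good H >]).
    by exists [set e in Q]; apply/asboolP.
  by exists H; split=> // H' /asboolP gH' sub; exact: max.
by rewrite -(maximal_good_full cover gH (norev H gH) max).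
Qed.

End Acyclicity.

(** The segment runs from the last visit of [S] before the first entry into [U] up to that entry. *)
Lemma path_crossing (T : eqType) (e : rel T) (S U : pred T) x (q : seq T) :
  (forall v, v \in S -> v \notin U) ->
  path e x q -> x \in S -> last x q \in U ->
  exists a w b, [/\ a \in S, b \in U, path e a (rcons w b),
    {subset rcons w b <= q} &
    forall v, v \in w -> v \notin S /\ v \notin U].
Proof.
move=> SU path_q xS lastU.
(* The first alternative lets the induction start at vertices outside [S]. *)
suff [[w [b [bU path_w sub avoid]]]|[a [w [b [aS bU path_w sub avoid]]]]] :
    (exists w b, [/\ b \in U, path e x (rcons w b), {subset rcons w b <= q} &
       forall v, v \in w -> v \notin S /\ v \notin U]) \/
    (exists a w b, [/\ a \in S, b \in U, path e a (rcons w b),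
       {subset rcons w b <= q} &
       forall v, v \in w -> v \notin S /\ v \notin U]).
- by exists x, w, b.
- by exists a, w, b.
have {xS} : q != [::] by apply/eqP => q0; move: lastU; rewrite q0 /=; apply/negP/SU.
elim: q x path_q lastU => [|y q IHq] x //= /andP[xy path_q] lastU _.
have [yU|yU] := boolP (y \in U).
  by left; exists [::], y; rewrite /= xy; split=> // v; rewrite !inE => ->.
have q0 : q != [::] by apply: contra yU => /eqP q0; move: lastU; rewrite q0.
have sub' (w : seq T) : {subset w <= q} -> {subset w <= y :: q}.
  by move=> sub v /sub vq; rewrite inE vq orbT.
have [[w [b [bU path_w sub avoid]]]|[a [w [b [aS bU path_w sub avoid]]]]] :=
  IHq y path_q lastU q0; last by right; exists a, w, b; split=> //; exact: sub'.
have [yS|yS] := boolP (y \in S).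
  by right; exists y, w, b; split=> //; exact: sub'.
left; exists (y :: w), b; rewrite /= xy; split=> //.
  by move=> v; rewrite !inE => /predU1P[->|/sub ->]; rewrite ?eqxx ?orbT.
by move=> v; rewrite inE => /predU1P[->|/avoid].
Qed.

(** * Single edge, parallel split or cut vertex *)

Section Decomposition.
Variables (G : network) (p : vertex G -> nat).
Hypothesis incr : increasing [set: edge G] p.
Implicit Types (A : {set edge G}) (S : {set vertex G}) (u v : vertex G).
Implicit Types (q : seq (vertex G)).

Lemma arc_lt A u v : arc A u v -> (p u < p v)%N.
Proof. by case/arcP=> e [_ <- <-]; apply: incr; rewrite inE. Qed.

Lemma path_lt A u v q : path (arc A) u q -> v \in q -> (p u < p v)%N.
Proof.
elim: q u => [|w q IHq] u //= /andP[/arc_lt uw pq]; rewrite inE => /predU1P[->//|vq].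
exact: ltn_trans uw (IHq _ pq vq).
Qed.

Lemma path_le A u v q : path (arc A) u q -> v \in u :: q -> (p u <= p v)%N.
Proof. by move=> pq; rewrite inE => /predU1P[->//|/(path_lt pq)/ltnW]. Qed.

Lemma path_le_last A u v q :
  path (arc A) u q -> v \in u :: q -> (p v <= p (last u q))%N.
Proof.
elim: q u v => [|w q IHq] u v /=; first by rewrite inE => _ /eqP->.
case/andP=> /arc_lt uw pq; rewrite [v \in _]inE => /predU1P[->|]; last exact: IHq.
exact: leq_trans (ltnW uw) (IHq w w pq (mem_head _ _)).
Qed.

Lemma connect_lt A u v : connect (arc A) u v -> u = v \/ (p u < p v)%N.
Proof.
case/connectP=> q pq ->; case: q pq => [|w q] pq; [by left | right].
by apply: path_lt pq _; rewrite /= mem_last.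
Qed.

Lemma connect_le A u v : connect (arc A) u v -> (p u <= p v)%N.
Proof. by case/connect_lt=> [->|/ltnW]. Qed.

(** Ranks thus act as positions, and segments of a path are described by inequalities between
    ranks. *)
Lemma path_rank_inj A u q v w :
  path (arc A) u q -> v \in u :: q -> w \in u :: q -> p v = p w -> v = w.
Proof.
elim: q u => [|x q IHq] u /=; first by rewrite !inE => _ /eqP-> /eqP->.
case/andP=> ux pq; rewrite [v \in _]inE [w \in _]inE.
have lt y : y \in x :: q -> (p u < p y)%N by apply: (@path_lt A); rewrite /= ux.
case/predU1P=> [->|vq] /predU1P[->|wq] //; last exact: IHq pq vq wq.
  by move=> eq_p; have := lt _ wq; rewrite eq_p ltnn.
by move=> eq_p; have := lt _ vq; rewrite eq_p ltnn.
Qed.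

Lemma path_pred A u q b :
  path (arc A) u q -> b \in q ->
  exists2 y, y \in u :: q &
    arc A y b /\ forall v, v \in u :: q -> (p v < p b)%N -> (p v <= p y)%N.
Proof.
elim: q u => [|x q IHq] u //= /andP[ux pq]; rewrite [b \in _]inE => /predU1P[->|bq].
  exists u; first exact: mem_head.
  split=> // v; rewrite inE => /predU1P[->//|/(path_le pq)].
  by rewrite leqNgt => /negbTE ->.
have [y yq [yb max]] := IHq x pq bq; exists y; first by rewrite inE yq orbT.
split=> // v; rewrite [v \in _]inE => /predU1P[->|/max //] _.
by apply: leq_trans (ltnW (arc_lt ux)) _; exact: path_le pq yq.
Qed.

Lemma connect_adj_in_sym A S : connect_sym (adj_in A S).
Proof.
by apply: sym_connect_sym => u v; rewrite /adj_in adj_sym andbCA.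
Qed.

Lemma sub_path_adj A u q : path (arc A) u q -> path (adj A) u q.
Proof. by apply: sub_path => v w vw; rewrite /adj vw. Qed.

Lemma path_segment A S u q a b :
  path (arc A) u q -> a \in u :: q -> b \in u :: q -> (p a <= p b)%N ->
  (forall v, v \in u :: q -> (p a <= p v <= p b)%N -> v \in S) ->
  connect (adj_in A S) a b.
Proof.
elim: q u a => [|x q IHq] u a /=.
  by rewrite !inE => _ /eqP-> /eqP-> _ _; exact: connect0.
case/andP=> ux pq; rewrite [a \in _]inE [b \in _]inE.
have lt y : y \in x :: q -> (p u < p y)%N by apply: (@path_lt A); rewrite /= ux.
case/predU1P=> [->|aq] /predU1P[->|bq] le inS.
- exact: connect0.
- apply: connect_trans (connect1 _) (IHq x x pq (mem_head _ _) bq _ _).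
  + have xb := path_le pq bq; have ux' := arc_lt ux.
    rewrite /adj_in /adj ux !inS ?andbT ?leqnn ?(ltnW ux') //=.
      by rewrite inE mem_head orbT.
    by rewrite mem_head.
  + exact: path_le pq bq.
  + move=> v vq /andP[xv vb]; apply: inS; first by rewrite inE vq orbT.
    by rewrite vb andbT ltnW // lt.
- by have := lt _ aq; rewrite ltnNge le.
- by apply: IHq pq aq bq le _ => v vq; apply: inS; rewrite inE vq orbT.
Qed.

Variables (A : {set edge G}) (s t : vertex G).
Hypotheses (A_span : spanned A s t) (A_norev : ~ has_reversal A s t).

Definition inner : {set vertex G} := [set v | (v != s) && (v != t)].

Lemma spanned_bounds e :
  e \in A -> [/\ (p s <= p (tail e))%N, (p (tail e) < p (head e))%N &
                 (p (head e) <= p t)%N].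
Proof.
move=> eA; have [/connect_le ? /connect_le ?] := A_span eA.
by split=> //; apply: incr; rewrite inE.
Qed.

Definition endpoint (e : edge G) v := (tail e == v) || (head e == v).

Definition ends (A : {set edge G}) v := [exists e in A, endpoint e v].

Lemma endsP (B : {set edge G}) v : reflect (exists2 e, e \in B & endpoint e v) (ends B v).
Proof. exact: exists_inP. Qed.

Section Indecomposable.
Variable q : seq (vertex G).
Hypotheses (path_q : path (arc A) s q) (last_q : last s q = t).
Hypotheses (st_lt : (p s < p t)%N) (no_st : ~~ arc A s t).
Hypothesis inner_connected : forall u v,
  u \in inner -> v \in inner -> ends A u -> ends A v ->
  connect (adj_in A inner) u v.
Hypothesis no_cut : forall m, m \in inner ->
  exists q', [/\ path (arc A) s q', last s q' = t & m \notin q'].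

Let P := s :: q.
Let sP : s \in P. Proof. exact: mem_head. Qed.
Let tP : t \in P. Proof. by rewrite -last_q mem_last. Qed.
Let tq : t \in q.
Proof. by have := tP; rewrite inE => /predU1P[ts|//]; move: st_lt; rewrite ts ltnn. Qed.

Let ear b := exists2 w, path (arc A) s (rcons w b) & {in w, forall v, v \notin P}.

(* The furthest vertex [b] of the path that an ear starting at [s] reaches.  As
   [b] is no cut vertex, an ear jumps over [b]; if [b] is not [t], the two ears
   and the path between their ends form a reversal. *)
Lemma bypass : ear t.
Proof.
have [b0 b0q ear0] : exists2 b, b \in q & ear b.
  case: q path_q tq => [|v q'] //= /andP[sv _] _; exists v; first exact: mem_head.
  by exists [::]; rewrite /= ?sv.
pose pb b := `[< b \in q /\ ear b >].
have pb0 : pb b0 by apply/asboolP.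
have [b /asboolP[bq [w1 path1 w1P]] max] := arg_maxnP p pb0.
have bP : b \in P by rewrite inE bq orbT.
have [<-|bt] := eqVneq b t; first by exists w1.
have sb : (p s < p b)%N by apply: path_lt path_q bq.
have b_inner : b \in inner.
  by rewrite inE bt andbT; apply/eqP => bs; move: sb; rewrite bs ltnn.
have [q' [path_q' last_q' bq']] := no_cut b_inner.
have le_t v : v \in P -> (p v <= p t)%N.
  by move=> vP; rewrite -last_q; exact: path_le_last path_q vP.
have rank_inj v w : v \in P -> w \in P -> p v = p w -> v = w.
  exact: path_rank_inj path_q.
have bt_lt : (p b < p t)%N.
  by rewrite ltn_neqAle le_t // andbT; apply: contraNneq bt => /rank_inj -> //.
pose S v := (v \in P) && (p v < p b)%N; pose U v := (v \in P) && (p b < p v)%N.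
(* A path avoiding [b] contains an ear from some [c] before [b] to some [d] after [b]. By the choice
   of [b], no ear from [s] ends in [d], so [c] is not [s] and the two ears do not meet. *)
have [c [w2 [d [/andP[cP cb] /andP[dP bd] path2 sub2 avoid2]]]] :
    exists a w b, [/\ a \in S, b \in U, path (arc A) a (rcons w b),
      {subset rcons w b <= q'} & forall v, v \in w -> v \notin S /\ v \notin U].
  apply: (path_crossing (x := s)) => //.
  - by move=> v /andP[_ lt]; apply/negP => /andP[_]; rewrite ltnNge ltnW.
  - by apply/andP.
  - by rewrite last_q'; apply/andP.
have w2P : {in w2, forall v, v \notin P}.
  move=> v vw; apply/negP => vP; have [] := avoid2 v vw.
  rewrite /S /U -!topredE /= vP -!leqNgt => vb bv.
  have vE : v = b by apply: rank_inj => //; apply/eqP; rewrite eqn_leq vb bv.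
  by case/negP: bq'; rewrite -vE sub2 // mem_rcons inE vw orbT.
have dq : d \in q.
  by move: dP; rewrite inE => /predU1P[ds|//]; move: bd; rewrite ds ltnNge ltnW.
have far : ~ ear d.
  move=> ear_d; have : (p d <= p b)%N by apply: max; apply/asboolP.
  by rewrite leqNgt bd.
have sc : (p s < p c)%N.
  rewrite ltn_neqAle (path_le path_q cP) andbT; apply/eqP => /(rank_inj _ _ sP cP) sc.
  by apply: far; exists w2; rewrite // sc.
have disj12 v : v \in w1 -> v \notin w2.
  move=> vw1; apply/negP => vw2; apply: far.
  case/splitPr: vw1 path1 w1P => u1 u2; rewrite rcons_cat cat_path => /andP[pu1 /=].
  case/andP=> last_v _ w1P.
  case/splitPr: vw2 path2 w2P => z1 z2; rewrite rcons_cat cat_path => /andP[_ /=].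
  case/andP=> _ pz2 w2P; exists (u1 ++ v :: z2).
    by rewrite rcons_cat cat_path pu1 /= last_v.
  move=> x; rewrite mem_cat => /orP[xu|xz]; last by apply: w2P; rewrite mem_cat xz orbT.
  by apply: w1P; rewrite mem_cat xu.
have [y yP [yb y_max]] := path_pred path_q bq.
have cy : (p c <= p y)%N by exact: y_max.
have yb_lt := arc_lt yb.
(* The reversal goes along [w1] to [b], against the arc from [y] to [b], back along the path to [c],
   then along [w2] to [d] and on to [t]. *)
case: A_norev; exists [set v | [|| v == s, v == b | v \in w1]].
exists [set v | [|| (v \in P) && (p c <= p v <= p y)%N, v \in w2 |
                   (v \in P) && (p d <= p v)%N]].
exists b, y; split=> //.
- apply/pred0P => v /=; apply/negP; rewrite !finset.in_set => /andP[].
  case/or3P=> [/eqP->|/eqP->|vw1].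
  + rewrite [s \in P]sP /= (ltn_geF sc) (leqNgt (p d)) (ltn_trans sb bd) orbF /=.
    by move/w2P; rewrite sP.
  + rewrite [b \in P]bP /= andbC (ltn_geF yb_lt) (ltn_geF bd) orbF /=.
    by move/w2P; rewrite bP.
  + by rewrite (negbTE (w1P v vw1)) (negbTE (disj12 v vw1)).
- by split; rewrite !finset.in_set ?eqxx ?yP ?tP ?cy ?leqnn ?le_t ?orbT.
- rewrite -[X in connect _ _ X](last_rcons s w1 b).
  apply: connect_adj_in_path; [exact: sub_path_adj path1 |].
  by move=> v; rewrite in_cons mem_rcons in_cons finset.in_set.
apply: (@connect_trans _ _ c).
  rewrite connect_adj_in_sym; apply: path_segment path_q cP yP cy _ => v vP bnd.
  by rewrite finset.in_set vP bnd.
apply: (@connect_trans _ _ d).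
  rewrite -[X in connect _ _ X](last_rcons c w2 d).
  apply: connect_adj_in_path; first exact: sub_path_adj path2.
  move=> v; rewrite inE mem_rcons inE => /or3P[/eqP->|/eqP->|vw2]; rewrite finset.in_set.
  - by rewrite cP leqnn cy.
  - by rewrite dP leqnn !orbT.
  - by rewrite vw2 orbT.
by apply: path_segment path_q dP tP (le_t _ dP) _ => v vP /andP[dv _]; rewrite finset.in_set vP dv !orbT.
Qed.

(** The path and its bypass are internally disjoint, and connectivity of the inner vertices yields
    an undirected link between them. Whichever way the first edge of this link points, an undirected
    path from [s] to [t] over the link traverses it backwards. *)
Lemma indecomposable_absurd : False.
Proof.
have [w path_w wP] := bypass.
have le_t v : v \in P -> (p v <= p t)%N.
  by move=> vP; rewrite -last_q; exact: path_le_last path_q vP.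
pose Q := s :: rcons w t.
have le_tQ v : v \in Q -> (p v <= p t)%N.
  by move=> vQ; rewrite -(last_rcons s w t); exact: path_le_last path_w vQ.
have tQ : t \in Q by rewrite in_cons mem_rcons mem_head orbT.
have memQ v : v \in Q -> [\/ v = s, v = t | v \in w].
  by rewrite in_cons mem_rcons in_cons => /or3P[/eqP h|/eqP h|h];
    [exact: Or31 | exact: Or32 | exact: Or33].
have [w0 w0w sw0] : exists2 w0, w0 \in w & arc A s w0.
  case: w path_w {wP Q le_tQ tQ memQ} => [|w0 w] /=; first by rewrite andbT (negbTE no_st).
  by case/andP=> sw0 _; exists w0; rewrite ?mem_head.
have [v1 v1P sv1] : exists2 v1, v1 \in q & arc A s v1.
  case: q path_q tq => [|v1 q'] //= /andP[sv1 _] _.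
  by exists v1; rewrite ?mem_head.
have ne_s v : (p s < p v)%N -> v != s by apply: contraTneq => ->; rewrite ltnn.
have v1_inner : v1 \in inner.
  rewrite inE ne_s ?(arc_lt sv1) //=; apply: contraNneq no_st => <-; exact: sv1.
have w_inner v : v \in w -> v \in inner.
  move=> vw; rewrite inE; have vP := wP v vw.
  by apply/andP; split; apply: contraNneq vP => ->.
have ends_head v : arc A s v -> ends A v.
  by case/arcP=> e [eA _ he]; apply/endsP; exists e; rewrite // /endpoint he eqxx orbT.
have /connectP[r path_r last_r] :=
  inner_connected v1_inner (w_inner _ w0w) (ends_head _ sv1) (ends_head _ sw0).
have [x [z [y [xP yw path_z _ avoid]]]] :
    exists a z b, [/\ a \in mem P, b \in mem w, path (adj_in A inner) a (rcons z b),
      {subset rcons z b <= r} & forall v, v \in z -> v \notin mem P /\ v \notin mem w].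
  apply: (path_crossing (x := v1)) => //.
  - by move=> v vP; apply/negP => /wP; rewrite vP.
  - by have : v1 \in P by rewrite in_cons v1P orbT.
  - by rewrite -last_r.
have in_inner v : v \in rcons z y -> v \in inner.
  move: path_z; elim: (rcons z y) (x) => [|k l IHl] u //= /andP[/and3P[_ kI _] pl].
  by rewrite inE => /predU1P[->|/(IHl _ pl)].
have x_inner : x \in inner.
  by case: (z) path_z => [|k l] /= /andP[/and3P[]].
have xt : (p x < p t)%N.
  rewrite ltn_neqAle le_t // andbT; apply: contraTneq x_inner.
  by move/(path_rank_inj path_q xP tP) ->; rewrite inE eqxx andbF.
have yQ : y \in Q by rewrite in_cons mem_rcons in_cons yw !orbT.
have sy : (p s < p y)%N by apply: path_lt path_w _; rewrite mem_rcons inE yw orbT.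
have yt : (p y < p t)%N.
  rewrite ltn_neqAle le_tQ // andbT; apply: contraTneq (w_inner _ yw).
  by move/(path_rank_inj path_w yQ tQ) ->; rewrite inE eqxx andbF.
have sx : (p s < p x)%N.
  rewrite ltn_neqAle (path_le path_q xP) andbT; apply: contraTneq x_inner.
  by move/(path_rank_inj path_q sP xP) <-; rewrite inE eqxx.
have zP v : v \in rcons z y -> v \notin P.
  by rewrite mem_rcons inE => /predU1P[->|/avoid[]] //; exact: wP.
have [z1 [z' zE]] : exists z1 z', rcons z y = z1 :: z'.
  by case: (z) => [|k l]; [exists y, [::] | exists k, (rcons l y)].
have last_z : last z1 z' = y by rewrite -(last_rcons x z y) zE.
move: path_z; rewrite zE /= => /andP[/and3P[_ _ xz1] path_z'].
have path_z'' : path (adj A) z1 z' by apply: sub_path path_z' => a b /and3P[].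
have zQ v : v \in rcons z y -> v \in Q -> v = y.
  rewrite mem_rcons in_cons => /predU1P[->//|vz]; have [vP vw] := avoid v vz.
  case/memQ=> [vs|vt|vw'].
  - by case/negP: vP; rewrite vs.
  - by case/negP: vP; rewrite vt.
  - by case/negP: vw.
(* If it points away from [x], the route takes the bypass to [y], the link to [x] and the path to
   [t]; otherwise the path to [x], the link to [y] and the bypass to [t]. *)
case/orP: xz1 => [xz1|z1x].
  case: A_norev.
  exists [set v | ((v \in Q) && (p v <= p y)%N) || (v \in rcons z y)].
  exists [set v | (v \in P) && (p x <= p v)%N], z1, x; split=> //.
  - apply/pred0P => v /=; apply/negP; rewrite !finset.in_set => /andP[+ /andP[vP xv]].
    case/orP=> [/andP[vQ vy]|/zP]; last by rewrite vP.
    case/memQ: vQ => [vs|vt|/wP]; last by rewrite vP.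
      by move: xv; rewrite vs leqNgt sx.
    by move: vy; rewrite vt leqNgt yt.
  - by split; rewrite !finset.in_set ?zE ?mem_head ?xP ?tP ?leqnn ?(ltnW sy) ?(ltnW xt) ?orbT.
  - apply: (@connect_trans _ _ y).
      apply: path_segment path_w (mem_head _ _) yQ (ltnW sy) _ => v vQ /andP[_ vy].
      by rewrite finset.in_set vQ vy.
    rewrite connect_adj_in_sym -[X in connect _ _ X]last_z; apply: connect_adj_in_path path_z'' _ => v.
    by rewrite -zE finset.in_set => ->; rewrite orbT.
  - apply: path_segment path_q xP tP (ltnW xt) _ => v vP /andP[xv _].
    by rewrite finset.in_set vP xv.
case: A_norev; exists [set v | (v \in P) && (p v <= p x)%N].
exists [set v | ((v \in Q) && (p y <= p v)%N) || (v \in rcons z y)], x, z1; split=> //.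
- apply/pred0P => v /=; apply/negP; rewrite !finset.in_set => /andP[/andP[vP vx]].
  case/orP=> [/andP[vQ vy]|/zP]; last by rewrite vP.
  case/memQ: vQ => [vs|vt|/wP]; last by rewrite vP.
    by move: vy; rewrite vs leqNgt sy.
  by move: vx; rewrite vt leqNgt xt.
- by split; rewrite !finset.in_set ?zE ?mem_head ?xP ?sP ?tQ ?leqnn ?(ltnW sx) ?(ltnW yt) ?orbT.
- apply: path_segment path_q sP xP (ltnW sx) _ => v vP /andP[_ vx].
  by rewrite finset.in_set vP vx.
apply: (@connect_trans _ _ y).
  rewrite -[X in connect _ _ X]last_z; apply: connect_adj_in_path path_z'' _ => v.
  by rewrite -zE finset.in_set => ->; rewrite orbT.
apply: path_segment path_w yQ tQ (ltnW yt) _ => v vQ /andP[yv _].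
by rewrite finset.in_set vQ yv.
Qed.

End Indecomposable.

Lemma decompose :
  A != finset.set0 ->
  [\/ exists e, [/\ A = [set e], tail e = s & head e = t],
      exists A1 A2, [/\ A1 != finset.set0, A2 != finset.set0, A1 :|: A2 = A,
        [disjoint A1 & A2] &
        forall v, ends A1 v -> ends A2 v -> v = s \/ v = t] |
      exists2 m, m \in inner & forall q, path (arc A) s q -> last s q = t -> m \in q].
Proof.
move=> /set0Pn[e0 e0A].
have st_lt : (p s < p t)%N.
  by have [? ? ?] := spanned_bounds e0A; lia.
(* Classes of edges connected through inner vertices meet only in the terminals. Two classes give a
   parallel split, and an edge from [s] to [t] is a class of its own. *)
pose link : rel (edge G) := fun e f => [&& e \in A, f \in A &
  [exists v in inner, endpoint e v && endpoint f v]].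
pose A1 := [set e in A | connect link e0 e].
have [A1E|A1N] := eqVneq A1 A; last first.
  apply: Or32; exists A1, (A :\: A1).
  have sub1 : A1 \subset A by apply/fintype.subsetP => e; rewrite inE => /andP[].
  split.
  - by apply/set0Pn; exists e0; rewrite inE e0A connect0.
  - rewrite finset.setD_eq0; apply: contra A1N => sub2.
    by rewrite finset.eqEsubset sub1.
  - by apply/setP => e; rewrite !inE; case: (e \in A); case: (connect _ _ _).
  - by rewrite disjoint_sym finset.disjoints_subset finset.setDE finset.subsetIr.
  move=> v /endsP[e1 e1A ev1] /endsP[e2 e2A ev2].
  have [->|vs] := eqVneq v s; first by left.
  have [->|vt] := eqVneq v t; first by right.
  move: e1A e2A; rewrite !inE => /andP[e1A con] /andP[]; rewrite negb_and => + e2A.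
  rewrite e2A /= => /negP[]; apply: connect_trans con (connect1 _).
  by rewrite /link e1A e2A; apply/exists_inP; exists v; rewrite ?inE ?vs ?ev1.
have con_all e : e \in A -> connect link e0 e.
  by rewrite -A1E inE => /andP[].
have [/arcP[e [eA te he]]|no_st] := boolP (arc A s t).
  apply: Or31; exists e; split=> //.
  have lone f : connect link e f -> f = e.
    case/connectP=> -[|k l] /=; first by move=> _ ->.
    case/andP=> /and3P[_ _ /exists_inP[v]]; rewrite inE /endpoint te he.
    by rewrite ![_ == v]eq_sym => /andP[/negbTE -> /negbTE ->].
  have link_sym : connect_sym link.
    apply: sym_connect_sym => f g; rewrite /link andbCA; congr [&& _, _ & _].
    by apply: eq_existsb => v; rewrite [endpoint f v && _]andbC.
  apply/setP => f; rewrite inE; apply/idP/eqP => [fA|->//].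
  by apply: lone; apply: connect_trans (con_all _ fA); rewrite link_sym con_all.
apply: Or33.
have inner_end e v : e \in A -> endpoint e v -> v \in inner ->
    forall u, endpoint e u -> u \in inner -> connect (adj_in A inner) u v.
  move=> eA + vI u + uI; have arc_e := arc_edge eA.
  case/orP=> /eqP ev /orP[]/eqP eu; rewrite -ev -eu; do ?exact: connect0;
    by apply: connect1; rewrite /adj_in eu ev uI vI -ev -eu /adj arc_e ?orbT.
have has_inner e : e \in A -> exists2 v, v \in inner & endpoint e v.
  move=> eA; have [h1 h2 h3] := spanned_bounds eA.
  have [ts|ts] := eqVneq (tail e) s; last first.
    exists (tail e); rewrite /endpoint ?eqxx // inE ts; apply/eqP => tt.
    by move: h2; rewrite tt ltnNge h3.
  exists (head e); rewrite /endpoint ?eqxx ?orbT // inE; apply/andP; split.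
    by apply/eqP => hs; move: h2; rewrite hs ltnNge h1.
  by apply: contraNneq no_st => <-; rewrite -ts; exact: arc_edge.
have inner_connected u v : u \in inner -> v \in inner -> ends A u -> ends A v ->
    connect (adj_in A inner) u v.
  have [v0 v0I e0v0] := has_inner _ e0A.
  have to0 e : connect link e0 e -> forall w, endpoint e w -> w \in inner ->
      connect (adj_in A inner) v0 w.
    case/connectP=> l; elim/last_ind: l e => [|l k IHl] e /=.
      by move=> _ -> w e0w wI; exact: inner_end e0w wI _ e0v0 v0I.
    rewrite rcons_path last_rcons => /andP[path_l /and3P[_ kA /exists_inP[x xI /andP[lx kx]]]].
    move=> -> w kw wI; apply: connect_trans (IHl _ path_l erefl x lx xI) _.
    exact: inner_end kw wI _ kx xI.
  move=> uI vI /endsP[eu euA euu] /endsP[ev evA evv].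
  apply: (@connect_trans _ _ v0); last exact: to0 (con_all _ evA) _ evv vI.
  by rewrite connect_adj_in_sym; exact: to0 (con_all _ euA) _ euu uI.
apply: contrapT => none.
have [h1 h2] := A_span e0A.
have /connectP[q path_q last_q] : connect (arc A) s t.
  exact: connect_trans h1 (connect_trans (connect1 (arc_edge e0A)) h2).
apply: (indecomposable_absurd path_q (esym last_q) st_lt no_st inner_connected).
move=> m mI; apply: contrapT => no; apply: none; exists m => // q' pq' lq'.
by apply/negPn/negP => mq'; apply: no; exists q'.
Qed.

End Decomposition.

(** * Passing to the parts of a split *)

Section Splitting.
Variables (G : network) (p : vertex G -> nat).
Hypothesis incr : increasing [set: edge G] p.
Implicit Types (A : {set edge G}) (u v : vertex G).

Lemma path_connect (T : finType) (r : rel T) x q y :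
  path r x q -> y \in x :: q -> connect r x y /\ connect r y (last x q).
Proof.
elim: q x y => [|z q IHq] x y /=; first by rewrite inE => _ /eqP->; rewrite connect0.
case/andP=> xz pq; have [_ zl] := IHq z z pq (mem_head _ _).
rewrite inE => /predU1P[->|/(IHq z y pq)[zy yl]].
  by rewrite connect0 (connect_trans (connect1 xz) zl).
by split=> //; exact: connect_trans (connect1 xz) zy.
Qed.

Lemma ends_edge A e : e \in A -> ends A (tail e) /\ ends A (head e).
Proof.
by move=> eA; split; apply/endsP; exists e; rewrite // /endpoint eqxx ?orbT.
Qed.

Lemma ends_arc A u v : arc A u v -> ends A u /\ ends A v.
Proof. by case/arcP=> e [/ends_edge[? ?] <- <-]. Qed.

Lemma adj_in_mono A A' (S S' : {set vertex G}) u v :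
  (forall a b, arc A a b -> a \in S -> b \in S ->
     [/\ arc A' a b, a \in S' & b \in S']) ->
  connect (adj_in A S) u v -> connect (adj_in A' S') u v.
Proof.
move=> sub; apply: connect_sub => {}u {}v /and3P[uS vS]; case/orP=> uv; apply: connect1.
  by have [h a b] := sub _ _ uv uS vS; rewrite /adj_in /adj h a b.
by have [h a b] := sub _ _ uv vS uS; rewrite /adj_in /adj h a b orbT.
Qed.

Lemma has_reversal_sub A A' s t :
  A \subset A' -> has_reversal A s t -> has_reversal A' s t.
Proof.
move=> sub [S1 [S2 [x [y [disj mem yx c1 c2]]]]]; exists S1, S2, x, y.
split=> //; first exact: arc_sub yx.
  by apply: adj_in_mono c1 => a b /(arc_sub sub).
by apply: adj_in_mono c2 => a b /(arc_sub sub).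
Qed.

(** A path can change from [A2] to [A1] only at a terminal, and the ranks allow none strictly inside
    it. *)
Lemma spanned_parallel A A1 A2 s t :
  spanned A s t -> A1 :|: A2 = A ->
  (forall v, ends A1 v -> ends A2 v -> v = s \/ v = t) ->
  spanned A1 s t.
Proof.
move=> span AE shared.
have arc_cases u v : arc A u v -> arc A1 u v \/ arc A2 u v.
  case/arcP=> e [+ te he]; rewrite -AE inE => /orP[eA|eA]; [left|right];
  by apply/arcP; exists e.
have from_s v q : path (arc A) s q -> last s q = v -> (p v < p t)%N -> ends A1 v ->
    connect (arc A1) s v.
  elim/last_ind: q v => [|q x IHq] v /=; first by move=> _ <- _ _; exact: connect0.
  rewrite rcons_path last_rcons => /andP[path_q step] <- xt endx.
  have [->|xs] := eqVneq x s; first exact: connect0.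
  have [step1|/ends_arc[_ end2]] := arc_cases _ _ step; last first.
    have [xE|xE] := shared x endx end2; first by rewrite xE eqxx in xs.
    by move: xt; rewrite xE ltnn.
  apply: connect_trans (IHq _ path_q erefl _ _) (connect1 step1).
    exact: ltn_trans (arc_lt incr step) xt.
  by have [] := ends_arc step1.
have to_t q v : path (arc A) v q -> last v q = t -> (p s < p v)%N -> ends A1 v ->
    connect (arc A1) v t.
  elim: q v => [|x q IHq] v /=; first by move=> _ -> _ _; exact: connect0.
  case/andP=> step path_q last_q sv endv.
  have [->|vt] := eqVneq v t; first exact: connect0.
  have [step1|/ends_arc[end2 _]] := arc_cases _ _ step; last first.
    have [vE|vE] := shared v endv end2; last by rewrite vE eqxx in vt.
    by move: sv; rewrite vE ltnn.
  apply: connect_trans (connect1 step1) (IHq _ path_q last_q _ _).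
    exact: ltn_trans sv (arc_lt incr step).
  by have [] := ends_arc step1.
move=> e eA1; have eA : e \in A by rewrite -AE inE eA1.
have [st_ te] := span e eA; have [h1 h2 h3] := spanned_bounds incr span eA.
have [end_t end_h] := ends_edge eA1; split.
  have /connectP[q path_q last_q] := st_.
  by apply: from_s path_q (esym last_q) _ end_t; exact: leq_trans h2 h3.
have /connectP[q path_q last_q] := te.
by apply: to_t path_q (esym last_q) _ end_h; exact: leq_ltn_trans h1 h2.
Qed.

Section Cut.
Variables (A : {set edge G}) (s t m : vertex G).
Hypotheses (A0 : A != finset.set0) (A_span : spanned A s t).
Hypotheses (A_norev : ~ has_reversal A s t) (m_inner : m \in inner s t).
Hypothesis cut : forall q, path (arc A) s q -> last s q = t -> m \in q.

Definition before := [set e in A | connect (arc A) (head e) m].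
Definition after := [set e in A | connect (arc A) m (tail e)].

Lemma cut_connect : connect (arc A) s m /\ connect (arc A) m t.
Proof.
have /set0Pn[e eA] := A0; have [h1 h2] := A_span eA.
have /connectP[q pq lq] : connect (arc A) s t.
  exact: connect_trans h1 (connect_trans (connect1 (arc_edge eA)) h2).
have mq : m \in s :: q by rewrite inE cut ?orbT.
by have := path_connect pq mq; rewrite -lq.
Qed.

(** On a path from [s] to [t] through [e], the vertex [m] occurs up to the tail or from the head of
    [e] on. *)
Lemma before_after : before :|: after = A.
Proof.
apply/setP => e; rewrite !inE -andb_orr andb_idr // => eA.
have [/connectP[q1 p1 l1] /connectP[q2 p2 l2]] := A_span eA.
have : m \in q1 ++ head e :: q2.
  apply: cut; last by rewrite last_cat.
  by rewrite cat_path p1 /= -l1 p2 arc_edge.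
rewrite mem_cat => /orP[mq|mq].
  have mq' : m \in s :: q1 by rewrite inE mq orbT.
  by have [_] := path_connect p1 mq'; rewrite -l1 => ->; rewrite orbT.
by have [-> _] := path_connect p2 mq.
Qed.

Lemma before_after_disjoint : [disjoint before & after].
Proof.
apply/pred0P => e /=; apply/negP; rewrite !inE.
case/andP=> /andP[eA /(connect_le incr) hm] /andP[_ /(connect_le incr) mt].
by have := arc_lt incr (arc_edge eA); rewrite ltnNge (leq_trans hm mt).
Qed.

Lemma ends_before v : ends before v -> connect (arc A) v m.
Proof.
case/endsP=> e; rewrite inE => /andP[eA hm] /orP[]/eqP<- //.
exact: connect_trans (connect1 (arc_edge eA)) hm.
Qed.

Lemma ends_after v : ends after v -> connect (arc A) m v.
Proof.
case/endsP=> e; rewrite inE => /andP[eA mt] /orP[]/eqP<- //.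
exact: connect_trans mt (connect1 (arc_edge eA)).
Qed.

Lemma before_sub : before \subset A.
Proof. by rewrite -before_after finset.subsetUl. Qed.

Lemma after_sub : after \subset A.
Proof. by rewrite -before_after finset.subsetUr. Qed.

Lemma connect_before u v :
  connect (arc A) u v -> connect (arc A) v m -> connect (arc before) u v.
Proof.
case/connectP=> q; elim: q u => [|x q IHq] u /=; first by move=> _ ->; rewrite connect0.
case/andP=> /arcP[e [eA te he]] pq vE vm.
apply: connect_trans (connect1 _) (IHq x pq vE vm); apply/arcP; exists e; split=> //.
rewrite inE eA he; apply: connect_trans vm; rewrite vE.
by have [] := path_connect pq (mem_last _ _).
Qed.

Lemma connect_after u v :
  connect (arc A) m u -> connect (arc A) u v -> connect (arc after) u v.
Proof.
move=> + /connectP[q]; elim: q u => [|x q IHq] u /=; first by move=> _ _ ->; rewrite connect0.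
move=> mu /andP[ux pq vE]; apply: connect_trans (connect1 _) (IHq x _ pq vE).
  by case/arcP: (ux) => e [eA te he]; apply/arcP; exists e; rewrite inE eA te.
exact: connect_trans mu (connect1 ux).
Qed.

Lemma before_spanned : spanned before s m.
Proof.
move=> e; rewrite inE => /andP[eA hm]; have [se _] := A_span eA.
split; last exact: connect_before hm (connect0 _ _).
by apply: connect_before se _; exact: connect_trans (connect1 (arc_edge eA)) hm.
Qed.

Lemma after_spanned : spanned after m t.
Proof.
move=> e; rewrite inE => /andP[eA mt]; have [_ et] := A_span eA.
split; first exact: connect_after (connect0 _ _) mt.
by apply: connect_after et; exact: connect_trans mt (connect1 (arc_edge eA)).
Qed.

Lemma connect_both v : connect (arc A) v m -> connect (arc A) m v -> v = m.
Proof.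
move=> vm /(connect_le incr) mv; have [//|] := connect_lt incr vm.
by rewrite ltnNge mv.
Qed.

(** A directed path from [m] to [t] extends such a reversal to one of [A]. [S1] is cut down to
    vertices that reach [m], so that it stays disjoint from those reachable from [m]. *)
Lemma before_no_reversal : ~ has_reversal before s m.
Proof.
move=> [S1 [S2 [x [y [disj [sS xS yS mS] yx c1 c2]]]]].
have [sm mt] := cut_connect.
have notS2 v : v \in S1 -> v \in S2 -> False.
  by move=> vS1 vS2; move/pred0P: disj => /(_ v) /=; rewrite vS1 vS2.
case: A_norev; exists (S1 :&: [set v | connect (arc A) v m]).
exists (S2 :|: [set v | connect (arc A) m v]), x, y; split.
- apply/pred0P => v /=; apply/negP; rewrite !inE => /andP[/andP[v1 vm]].
  case/orP=> [v2|mv]; first exact: notS2 v1 v2.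
  by apply: (notS2 v v1); rewrite (connect_both vm mv).
- have [_ /ends_before xm] := ends_arc yx.
  by rewrite !inE sS xS yS sm xm mt orbT.
- exact: arc_sub before_sub yx.
- apply: adj_in_mono c1 => a b ab aS bS; have [/ends_before am /ends_before bm] := ends_arc ab.
  by rewrite !inE aS bS am bm; split=> //; exact: arc_sub before_sub ab.
apply: (@connect_trans _ _ m).
  apply: adj_in_mono c2 => a b ab aS bS; rewrite !inE aS bS; split=> //.
  exact: arc_sub before_sub ab.
case/connectP: mt => q pq ->; apply: connect_adj_in_path; first exact: sub_path_adj pq.
by move=> v vq; rewrite !inE; have [-> _] := path_connect pq vq; rewrite orbT.
Qed.

Lemma after_no_reversal : ~ has_reversal after m t.
Proof.
move=> [S1 [S2 [x [y [disj [mS xS yS tS] yx c1 c2]]]]].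
have [sm mt] := cut_connect.
have notS1 v : v \in S1 -> v \in S2 -> False.
  by move=> vS1 vS2; move/pred0P: disj => /(_ v) /=; rewrite vS1 vS2.
case: A_norev; exists (S1 :|: [set v | connect (arc A) v m]).
exists (S2 :&: [set v | connect (arc A) m v]), x, y; split.
- apply/pred0P => v /=; apply/negP; rewrite !inE => /andP[+ /andP[v2 mv]].
  case/orP=> [v1|vm]; first exact: notS1 v1 v2.
  by apply: (notS1 m mS); rewrite -(connect_both vm mv).
- have [/ends_after my _] := ends_arc yx.
  by rewrite !inE xS yS tS sm my mt orbT.
- exact: arc_sub after_sub yx.
- apply: (@connect_trans _ _ m); last first.
    apply: adj_in_mono c1 => a b ab aS bS; rewrite !inE aS bS; split=> //.
    exact: arc_sub after_sub ab.
  case/connectP: sm => q pq mE; rewrite [X in connect _ _ X]mE.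
  apply: connect_adj_in_path; first exact: sub_path_adj pq.
  by move=> v vq; rewrite !inE mE; have [_ ->] := path_connect pq vq; rewrite orbT.
apply: adj_in_mono c2 => a b ab aS bS; have [/ends_after ma /ends_after mb] := ends_arc ab.
by rewrite !inE aS bS ma mb; split=> //; exact: arc_sub after_sub ab.
Qed.

Lemma before_neq0 : before != finset.set0.
Proof.
have [/connectP[q + mE] _] := cut_connect.
elim/last_ind: q mE => [|q x _].
  by move=> /= ms; move: m_inner; rewrite inE ms eqxx.
rewrite last_rcons rcons_path => <- /andP[_ /arcP[e [eA _ he]]].
by apply/set0Pn; exists e; rewrite inE eA he connect0.
Qed.

Lemma after_neq0 : after != finset.set0.
Proof.
have [_ /connectP[[|x q]]] := cut_connect.
  by move=> _ /= tm; move: m_inner; rewrite inE tm eqxx andbF.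
move=> /= /andP[/arcP[e [eA te _]] _] _.
by apply/set0Pn; exists e; rewrite inE eA te connect0.
Qed.

End Cut.
End Splitting.

(** * Subnetworks and their series-parallel structure *)

Section Subnetworks.
Variable G : network.
Implicit Types (A : {set edge G}) (s t u v : vertex G).

Definition sub_vertex A s t v := [|| v == s, v == t | ends A v].

Lemma sub_vertex_tail A s t (e : {e : edge G | e \in A}) :
  sub_vertex A s t (tail (sval e)).
Proof. by rewrite /sub_vertex; have [-> _] := ends_edge (svalP e); rewrite !orbT. Qed.

Lemma sub_vertex_head A s t (e : {e : edge G | e \in A}) :
  sub_vertex A s t (head (sval e)).
Proof. by rewrite /sub_vertex; have [_ ->] := ends_edge (svalP e); rewrite !orbT. Qed.

Lemma sub_vertex_source A s t : sub_vertex A s t s.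
Proof. by rewrite /sub_vertex eqxx. Qed.

Lemma sub_vertex_sink A s t : sub_vertex A s t t.
Proof. by rewrite /sub_vertex eqxx orbT. Qed.

Definition subnetwork A s t : network :=
  @Network {v : vertex G | sub_vertex A s t v} {e : edge G | e \in A}
    (fun e => exist _ (tail (sval e)) (sub_vertex_tail s t e))
    (fun e => exist _ (head (sval e)) (sub_vertex_head s t e))
    (exist _ s (sub_vertex_source A s t)) (exist _ t (sub_vertex_sink A s t)).

Definition sub_incl (P Q : pred (vertex G)) (PQ : forall v, P v -> Q v)
  (u : {v | P v}) : {v | Q v} := exist _ (sval u) (PQ _ (svalP u)).

Lemma subnetwork_merged A1 A2 A s1 t1 s2 t2 s t
    (H1 : forall v, sub_vertex A1 s1 t1 v -> sub_vertex A s t v)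
    (H2 : forall v, sub_vertex A2 s2 t2 v -> sub_vertex A s t v)
    (merged : vertex (subnetwork A1 s1 t1) -> vertex (subnetwork A2 s2 t2) -> Prop) :
  A1 :|: A2 = A -> [disjoint A1 & A2] ->
  (forall v, sub_vertex A s t v -> sub_vertex A1 s1 t1 v || sub_vertex A2 s2 t2 v) ->
  (forall (u : {v | sub_vertex A1 s1 t1 v}) (v : {v | sub_vertex A2 s2 t2 v}),
     sval u = sval v <-> merged u v) ->
  @is_merged_union (subnetwork A1 s1 t1) (subnetwork A2 s2 t2) (subnetwork A s t)
    merged (sub_incl H1) (sub_incl H2).
Proof.
move=> AE disj cover mergedP.
have sub1 e : e \in A1 -> e \in A by rewrite -AE inE => ->.
have sub2 e : e \in A2 -> e \in A by rewrite -AE inE orbC => ->.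
split; first by move=> u v [] uv; apply: val_inj.
split; first by move=> u v [] uv; apply: val_inj.
split=> [u v|].
  split; first by move=> [] uv; apply/mergedP.
  by move/mergedP => uv; apply: val_inj.
split=> [w|].
  have /orP[w1|w2] := cover _ (svalP w); [left|right].
    by exists (exist _ (sval w) w1); apply: val_inj.
  by exists (exist _ (sval w) w2); apply: val_inj.
pose j (e : edge (subnetwork A1 s1 t1) + edge (subnetwork A2 s2 t2)) :
    edge (subnetwork A s t) := match e with
  | inl e1 => exist _ (sval e1) (sub1 _ (svalP e1))
  | inr e2 => exist _ (sval e2) (sub2 _ (svalP e2)) end.
exists j; split; last first.
  by split=> e; split; apply: val_inj.
apply: inj_card_bij => [|]; last first.
  rewrite card_sum !card_sig -cardsUI /= AE.
  by rewrite leq_addr.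
have notA2 e : e \in A1 -> e \in A2 -> False.
  by move=> e1 e2; move/pred0P: disj => /(_ e) /=; rewrite e1 e2.
move=> [e1|e2] [f1|f2] /= [] eq_val.
- by congr inl; apply: val_inj.
- by case: (notA2 (sval e1)); [exact: svalP e1 | rewrite eq_val; exact: svalP f2].
- by case: (notA2 (sval f1)); [exact: svalP f1 | rewrite -eq_val; exact: svalP e2].
- by congr inr; apply: val_inj.
Qed.

End Subnetworks.

Lemma merged_union_iso (G1 G2 G G' : network) merged
    (i1 : vertex G1 -> vertex G) (i2 : vertex G2 -> vertex G)
    (f : vertex G -> vertex G') (g : edge G -> edge G') :
  bijective f -> bijective g ->
  (forall e, tail (g e) = f (tail e)) -> (forall e, head (g e) = f (head e)) ->
  is_merged_union merged i1 i2 -> is_merged_union merged (f \o i1) (f \o i2).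
Proof.
move=> bf bg tg hg [inj1 [inj2 [mergedP [cover [j [bj [j1 j2]]]]]]].
have injf := bij_inj bf; do 2!(split; first exact: inj_comp).
split=> [u v|]; first by rewrite -mergedP; split=> [/injf|/= ->].
split=> [w|].
  have [k _ fK] := bf; rewrite -(fK w).
  by case: (cover (k w)) => -[u ->]; [left|right]; exists u.
exists (g \o j); split; first exact: bij_comp.
by split=> e /=; rewrite tg hg; [have [-> ->] := j1 e | have [-> ->] := j2 e].
Qed.

(** Only the outermost composition refers to [G], so composing its embeddings with the isomorphism
    suffices and no induction is required. *)
Lemma series_parallel_iso (G G' : network)
    (f : vertex G -> vertex G') (g : edge G -> edge G') :
  bijective f -> bijective g ->
  (forall e, tail (g e) = f (tail e)) -> (forall e, head (g e) = f (head e)) ->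
  f (source G) = source G' -> f (sink G) = sink G' ->
  series_parallel G -> series_parallel G'.
Proof.
move=> bf bg tg hg fs ft spG.
case: spG f g bf bg tg hg fs ft => {G} [G [st [all_v [e [te [he all_e]]]]]
  |G1 G2 G sp1 sp2 [i1 [i2 [mu [sE tE]]]]
  |G1 G2 G sp1 sp2 [i1 [i2 [mu [sE tE]]]]] f g bf bg tg hg fs ft.
- apply: SP_edge; split; first by rewrite -fs -ft => /(bij_inj bf).
  split=> [v|].
    have [k _ fK] := bf; rewrite -(fK v) -fs -ft.
    by case: (all_v (k v)) => ->; [left|right].
  exists (g e); rewrite tg hg te he; do 2!split=> //.
  have [k _ gK] := bg; move=> e'; rewrite -(gK e'); congr g; exact: all_e.
- apply: SP_parallel sp1 sp2 _; exists (f \o i1), (f \o i2).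
  by rewrite -fs -ft sE tE; split=> //; exact: merged_union_iso bf bg tg hg mu.
apply: SP_serial sp1 sp2 _; exists (f \o i1), (f \o i2).
by rewrite -fs -ft sE tE; split=> //; exact: merged_union_iso bf bg tg hg mu.
Qed.

(** Induction on the number of edges: both parts of a split are nonempty, hence smaller, and inherit
    spanning and the absence of reversals. *)
Lemma subnetwork_series_parallel (G : network) (p : vertex G -> nat)
    (A : {set edge G}) s t :
  increasing [set: edge G] p -> A != finset.set0 -> spanned A s t ->
  ~ has_reversal A s t -> series_parallel (subnetwork A s t).
Proof.
move=> incr; have [n] := ubnP #|A|.
elim: n A s t => // n IHn A s t; rewrite ltnS => leA A0 span norev.
have [e0 e0A] := set0Pn _ A0.
have st_lt : (p s < p t)%N by have [? ? ?] := spanned_bounds incr span e0A; lia.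
have card_pos (B : {set edge G}) : B != finset.set0 -> (0 < #|B|)%N.
  by rewrite card_gt0.
have [[e [AE te he]]|[A1 [A2 [A1_0 A2_0 AE disj shared]]]|[m mI cut]] :=
  decompose incr span norev A0.
- have eA : e \in A by rewrite AE inE.
  apply: SP_edge; split; first by case=> st; move: st_lt; rewrite st ltnn.
  split=> [[v vP]|].
    have : (v == s) || (v == t).
      case/or3P: (vP) => [->|->|/endsP[f]]; rewrite ?orbT //.
      by rewrite AE inE => /eqP ->; rewrite /endpoint te he ![_ == v]eq_sym.
    by case/orP=> /eqP vE; [left|right]; apply: val_inj.
  exists (exist _ e eA); split; first exact: val_inj.
  split; first exact: val_inj.
  by move=> [f fA]; apply: val_inj => /=; move: fA; rewrite AE inE => /eqP.
- have shared' v : ends A2 v -> ends A1 v -> v = s \/ v = t by move=> ? ?; exact: shared.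
  have AE' : A2 :|: A1 = A by rewrite finset.setUC.
  have cardA : (#|A1| + #|A2| = #|A|)%N.
    by rewrite -cardsUI AE (eqP (_ : A1 :&: A2 == finset.set0)) ?cards0 ?addn0 ?setI_eq0.
  have sp1 : series_parallel (subnetwork A1 s t).
    apply: IHn => //; first by have := card_pos _ A2_0; lia.
      exact: (spanned_parallel incr span AE shared).
    by move=> rev; apply/norev/(has_reversal_sub _ rev); rewrite -AE finset.subsetUl.
  have sp2 : series_parallel (subnetwork A2 s t).
    apply: IHn => //; first by have := card_pos _ A1_0; lia.
      exact: (spanned_parallel incr span AE' shared').
    by move=> rev; apply/norev/(has_reversal_sub _ rev); rewrite -AE finset.subsetUr.
  have endsE v : ends A v = ends A1 v || ends A2 v.
    apply/endsP/orP => [[e]|[]/endsP[e eA ev]].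
    + by rewrite -AE inE => /orP[] eA ev; [left|right]; apply/endsP; exists e.
    + by exists e; rewrite // -AE inE eA.
    + by exists e; rewrite // -AE inE eA orbT.
  have H1 v : sub_vertex A1 s t v -> sub_vertex A s t v.
    by rewrite /sub_vertex endsE => /or3P[->|->|->]; rewrite ?orbT.
  have H2 v : sub_vertex A2 s t v -> sub_vertex A s t v.
    by rewrite /sub_vertex endsE => /or3P[->|->|->]; rewrite ?orbT.
  apply: SP_parallel sp1 sp2 _; exists (sub_incl H1), (sub_incl H2).
  split; last by split; apply: val_inj.
  apply: subnetwork_merged => // [v|[u uP] [v vP] /=].
    by rewrite /sub_vertex endsE => /or4P[->|->|->|->]; rewrite ?orbT.
  split=> [uv|[] [[->] [->]] //]; subst v.
  have [us|us] := eqVneq u s; first by left; split; apply: val_inj.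
  have [ut|ut] := eqVneq u t; first by right; split; apply: val_inj.
  have inner_end B : sub_vertex B s t u -> ends B u.
    by case/or3P=> // uE; [rewrite uE in us | rewrite uE in ut].
  by have [uE|uE] := shared u (inner_end _ uP) (inner_end _ vP);
    [rewrite uE eqxx in us | rewrite uE eqxx in ut].
have AE := before_after span cut; have disj := before_after_disjoint incr A m.
have cardA : (#|before A m| + #|after A m| = #|A|)%N.
  by rewrite -cardsUI AE (eqP (_ : before A m :&: after A m == finset.set0))
    ?cards0 ?addn0 ?setI_eq0.
have n1 := before_neq0 A0 span mI cut; have n2 := after_neq0 A0 span mI cut.
have sp1 : series_parallel (subnetwork (before A m) s m).
  apply: IHn => //; first by have := card_pos _ n2; lia.
    exact: (before_spanned span).
  exact: (before_no_reversal incr A0 span norev cut).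
have sp2 : series_parallel (subnetwork (after A m) m t).
  apply: IHn => //; first by have := card_pos _ n1; lia.
    exact: (after_spanned span).
  exact: (after_no_reversal incr A0 span norev cut).
have endsE v : ends A v = ends (before A m) v || ends (after A m) v.
  apply/endsP/orP => [[e]|[]/endsP[e eA ev]].
  + by rewrite -{1}AE inE => /orP[] eA ev; [left|right]; apply/endsP; exists e.
  + by exists e; rewrite // -AE inE eA.
  + by exists e; rewrite // -AE inE eA orbT.
have [sm mt] := cut_connect A0 span cut.
have end_m : ends (before A m) m.
  have [e] := set0Pn _ n1; rewrite inE => /andP[_].
  have /connectP[q + mE] := connect_before sm (connect0 _ _).
  elim/last_ind: q mE => [|q x _] /=.
    by move=> ms; move: mI; rewrite inE ms eqxx.
  by rewrite last_rcons rcons_path => <- /andP[_ /ends_arc[_ ->]].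
have H1 v : sub_vertex (before A m) s m v -> sub_vertex A s t v.
  by rewrite /sub_vertex endsE => /or3P[->|/eqP->|->]; rewrite ?end_m ?orbT.
have H2 v : sub_vertex (after A m) m t v -> sub_vertex A s t v.
  by rewrite /sub_vertex endsE => /or3P[/eqP->|->|->]; rewrite ?end_m ?orbT.
apply: SP_serial sp1 sp2 _; exists (sub_incl H1), (sub_incl H2).
split; last by split; apply: val_inj.
apply: subnetwork_merged => // [v|[u uP] [v vP] /=].
  by rewrite /sub_vertex endsE => /or4P[->|->|->|->]; rewrite ?orbT.
split=> [uv|[[->] [->]] //]; subst v.
(* A vertex shared by both parts reaches [m] and is reachable from it. *)
have um : u = m.
  apply: (connect_both incr (A := A)).
    by case/or3P: uP => [/eqP->|/eqP->|/ends_before].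
  by case/or3P: vP => [/eqP->|/eqP->|/ends_after].
by split; apply: val_inj.
Qed.

Lemma series_parallel_of_no_reversal (G : network) (p : vertex G -> nat) :
  increasing [set: edge G] p -> source G != sink G ->
  (forall v : vertex G, v = source G \/ ends [set: edge G] v) ->
  connect (arc [set: edge G]) (source G) (sink G) ->
  spanned [set: edge G] (source G) (sink G) ->
  ~ has_reversal [set: edge G] (source G) (sink G) -> series_parallel G.
Proof.
move=> incr st all_ends con span norev.
have E0 : [set: edge G] != finset.set0.
  case/connectP: con => -[|v q] /=; first by move=> _ ts; rewrite ts eqxx in st.
  by case/andP=> /arcP[e [eE _ _]] _ _; apply/set0Pn; exists e.
have subT v : sub_vertex [set: edge G] (source G) (sink G) v.
  by rewrite /sub_vertex; case: (all_ends v) => ->; rewrite ?eqxx ?orbT.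
pose f (v : vertex (subnetwork [set: edge G] (source G) (sink G))) := sval v.
pose g (e : edge (subnetwork [set: edge G] (source G) (sink G))) := sval e.
apply: (@series_parallel_iso _ G f g) (subnetwork_series_parallel incr E0 span norev) => //.
  exists (fun v => exist _ v (subT v)) => v //; exact: val_inj.
exists (fun e => exist _ e (finset.in_setT e)) => e //; exact: val_inj.
Qed.

(* Standing convention for networks: the terminals are distinct and every vertex
   and every edge lies on some directed s-t-path. *)
Theorem theorem2 (R : realType) (G : network)
    (hst : source G <> sink G)
    (hvertex : forall v : vertex G, exists P : st_path G, v \in path_vertices P)
    (hedge : forall e : edge G, exists P : st_path G, e \in path_edges P) :
  full_information_always_optimal R G <-> series_parallel G.
Proof.
have reach v : exists p, walk (source G) v p.
  have [P] := hvertex v; rewrite inE => /predU1P[->|/mapP[e eP ->]].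
    by exists [::]; rewrite /= eqxx.
  have := path_walk P; case/splitPr: eP => p q.
  by rewrite walk_split => /andP[wp _]; exists (rcons p e); rewrite -cats1 walk_split wp /=.
split; last exact: sp_full_information_optimal.
move=> opt; have st : source G != sink G by apply/eqP.
have cover e : exists Q, [/\ walk (source G) (sink G) Q,
    uniq (vertices_from (source G) Q) & e \in Q].
  have [P eP] := hedge e; exists (path_edges P).
  by split=> //; [exact: path_walk | exact: path_uniq].
have norev H : good (source G) (sink G) H -> ~ has_reversal H (source G) (sink G).
  by move=> [[p incr] span _] rev; exact: reversal_not_optimal reach incr span rev opt.
have some_path : exists2 Q, walk (source G) (sink G) Q & uniq (vertices_from (source G) Q).
  have [P _] := hvertex (source G); exists (path_edges P); first exact: path_walk.
  exact: path_uniq.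
have goodT := increasing_of_no_reversal cover some_path st norev.
have [[p incr] span con] := goodT.
apply: (series_parallel_of_no_reversal incr st) => // [v|]; last exact: norev.
have [->|vs] := eqVneq v (source G); [by left | right].
have [P] := hvertex v; rewrite inE (negbTE vs) /= => /mapP[e _ ->].
by have [] := ends_edge (finset.in_setT e).
Qed.
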